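(* Consider the stochastic knapsack problem with random profits described in the context, and let $OPT=\max\{\Pr(v(S)\ge T): S\subseteq U,\ w(S)\le1\}$. If $OPT=\Omega(1)$, then for any constant $\epsilon>0$ one can find in polynomial time a subset $S$ of items such that $\Pr(v(S)>(1-\epsilon)T)\ge(1-\epsilon)OPT$ and $w(S)\le1+\epsilon$.
   Context: Stochastic knapsack with random profits: a set $U$ of $n$ items is given; item $i$ has a deterministic nonnegative size $w_i$ and a random nonnegative profit $v_i$, the profits being mutually independent (with $\mathbb{E}[\phi^{v_i}]$ computable for complex $|\phi|\le1$). The knapsack has capacity $1$ and a profit threshold $T>0$ is given. For $S\subseteq U$ write $w(S)=\sum_{i\in S}w_i$ and $v(S)=\sum_{i\in S}v_i$. The goal is to choose $S$ with $w(S)\le1$ maximizing $\Pr(v(S)\ge T)$. *)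

(* Defs.v *)
(* MathComp / MathComp-Analysis *)
From HB Require Import structures.
From mathcomp Require Import all_boot all_order all_algebra.
From mathcomp Require Import all_classical all_reals all_analysis.

Set Implicit Arguments.
Unset Strict Implicit.
Unset Printing Implicit Defensive.

Import Order.TTheory GRing.Theory Num.Theory.

Local Open Scope classical_set_scope.
Local Open Scope ring_scope.

(** * Model of computation

    Programs are uniform: their syntax contains no real number and no
    dimension, only natural-number constants.  They run on a random access
    machine with two memories, one of natural numbers and one of real numbers,
    each organized as countably many named arrays of infinite length.  Natural
    numbers are charged their bit length.  Reals support the field operations
    and comparison, but no rounding and no conversion to a natural number.

    A real cell also carries a formal length.  An input datum has length 1, and
    the result of an operation has one plus the sum of the lengths of its
    operands.  If the numerators and denominators of all input data have at
    most [B] bits, a cell of length [l] holds a fraction whose numerator and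
    denominator have at most [B * l] bits.  Real operations are charged by
    this length, so that a large number of exact bits cannot be produced by
    repeated squaring at unit cost: a program of polynomial cost also runs in
    polynomial bit complexity on rational data. *)

Definition bitlen (k : nat) : nat := (trunc_log 2 k).+1.

Inductive nop := NAdd | NSub | NMul | NDiv.

Inductive nexp :=
| NCst of nat
| NGet of nat & nexp               (* array name, position *)
| NOp of nop & nexp & nexp.

Inductive rop := RAdd | RSub | RMul | RDiv.

Inductive rexp :=
| RNat of nexp
| RGet of nat & nexp
| ROp of rop & rexp & rexp.

Inductive test :=
| NLe of nexp & nexp
| RLe of rexp & rexp
| TNot of test.

Inductive cmd :=
| Skip
| Then of cmd & cmd
| NSet of nat & nexp & nexp        (* array name, position, new value *)
| RSet of nat & nexp & rexp
| Query of nat & nexp & rexp & rexp & rexp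
                                   (* array name, item, a, b, accuracy *)
| If of test & cmd & cmd
| While of test & cmd.

Record state (R : realType) := State {
  nmem : nat -> nat -> nat ;
  rmem : nat -> nat -> R * nat     (* value, length *)
}.

Definition write (V : Type) (m : nat -> nat -> V) (x i : nat) (a : V) :
    nat -> nat -> V :=
  fun y j => if (y == x) && (j == i) then a else m y j.

Definition napply (o : nop) (k l : nat) : nat :=
  match o with
  | NAdd => (k + l)%N
  | NSub => (k - l)%N
  | NMul => (k * l)%N
  | NDiv => (k %/ l)%N
  end.

Definition rapply (R : realType) (o : rop) (x y : R) : R :=
  match o with
  | RAdd => x + y
  | RSub => x - y
  | RMul => x * y
  | RDiv => x / y
  end.

(* The evaluators return the value (for reals, with its length) and the cost. *)

Fixpoint neval (R : realType) (s : state R) (e : nexp) : nat * nat :=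
  match e with
  | NCst k => (k, bitlen k)
  | NGet x e1 =>
      let: (i, c) := neval s e1 in
      (nmem s x i, (c + bitlen (nmem s x i))%N)
  | NOp o e1 e2 =>
      let: (k1, c1) := neval s e1 in
      let: (k2, c2) := neval s e2 in
      (napply o k1 k2, (c1 + c2 + bitlen (napply o k1 k2))%N)
  end.

Fixpoint reval (R : realType) (s : state R) (e : rexp) : (R * nat) * nat :=
  match e with
  | RNat e1 =>
      let: (k, c) := neval s e1 in
      ((k%:R, bitlen k), (c + bitlen k)%N)
  | RGet x e1 =>
      let: (i, c) := neval s e1 in
      (rmem s x i, (c + (rmem s x i).2)%N)
  | ROp o e1 e2 =>
      let: ((x1, l1), c1) := reval s e1 in
      let: ((x2, l2), c2) := reval s e2 in
      ((rapply o x1 x2, (l1 + l2).+1), (c1 + c2 + (l1 + l2).+1)%N)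
  end.

Fixpoint teval (R : realType) (s : state R) (t : test) : bool * nat :=
  match t with
  | NLe e1 e2 =>
      let: (k1, c1) := neval s e1 in
      let: (k2, c2) := neval s e2 in
      ((k1 <= k2)%N, (c1 + c2).+1)
  | RLe e1 e2 =>
      let: ((x1, l1), c1) := reval s e1 in
      let: ((x2, l2), c2) := reval s e2 in
      (x1 <= x2, (c1 + c2).+1)
  | TNot t1 =>
      let: (b, c) := teval s t1 in (~~ b, c.+1)
  end.

(* [q i a b delta] is the answer, a complex number given by its real and
   imaginary parts, to the query (a, b, delta) about item i. *)
Definition oracle (R : realType) := nat -> R -> R -> R -> R * R.

(* [exec q p s s' c]: with oracle [q], program [p] started in [s] halts in
   [s'] after a computation of cost [c]. *)
Inductive exec (R : realType) (q : oracle R) :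
    cmd -> state R -> state R -> nat -> Prop :=
| ExecSkip s : exec q Skip s s 1
| ExecThen p1 p2 s s1 s2 c1 c2 :
    exec q p1 s s1 c1 -> exec q p2 s1 s2 c2 ->
    exec q (Then p1 p2) s s2 (c1 + c2).+1
| ExecNSet x e1 e2 s i k c1 c2 :
    neval s e1 = (i, c1) -> neval s e2 = (k, c2) ->
    exec q (NSet x e1 e2) s (State (write (nmem s) x i k) (rmem s))
      (c1 + c2).+1
| ExecRSet x e1 e2 s i a c1 c2 :
    neval s e1 = (i, c1) -> reval s e2 = (a, c2) ->
    exec q (RSet x e1 e2) s (State (nmem s) (write (rmem s) x i a))
      (c1 + c2).+1
(* The answer is stored in positions 0 (real part) and 1 (imaginary part). *)
| ExecQuery x e ea eb ed s i a b delta la lb ld c ca cb cd :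
    neval s e = (i, c) -> reval s ea = ((a, la), ca) ->
    reval s eb = ((b, lb), cb) -> reval s ed = ((delta, ld), cd) ->
    let l := (la + lb + ld).+1 in
    exec q (Query x e ea eb ed) s
      (State (nmem s)
        (write (write (rmem s) x 0%N ((q i a b delta).1, l))
               x 1%N ((q i a b delta).2, l)))
      (c + ca + cb + cd + l)
| ExecIfTrue t p1 p2 s s' c c1 :
    teval s t = (true, c) -> exec q p1 s s' c1 ->
    exec q (If t p1 p2) s s' (c + c1).+1
| ExecIfFalse t p1 p2 s s' c c1 :
    teval s t = (false, c) -> exec q p2 s s' c1 ->
    exec q (If t p1 p2) s s' (c + c1).+1
| ExecWhileTrue t p s s1 s2 c c1 c2 :
    teval s t = (true, c) -> exec q p s s1 c1 ->
    exec q (While t p) s1 s2 c2 ->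
    exec q (While t p) s s2 (c + c1 + c2).+1
| ExecWhileFalse t p s c :
    teval s t = (false, c) -> exec q (While t p) s s c.+1.

Lemma exec_det (R : realType) (q : oracle R) p s s1 s2 c1 c2 :
  exec q p s s1 c1 -> exec q p s s2 c2 -> s1 = s2 /\ c1 = c2.
Proof.
move=> H; elim: H s2 c2 => {p s s1 c1}; intros;
  match goal with H : exec _ _ _ _ _ |- _ => inversion H; subst; clear H end;
  repeat match goal with
  | H1 : ?e = _, H2 : ?e = _ |- _ =>
      rewrite H1 in H2; try discriminate H2; injection H2; clear H2; intros; subst
  | IH : forall s c, exec _ _ _ s c -> _, H : exec _ _ _ _ _ |- _ =>
      let E1 := fresh in let E2 := fresh in
      destruct (IH _ _ H) as [E1 E2]; clear IH; subst
  end; by [].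
Qed.

(** * Stochastic knapsack with random profits *)

Section Knapsack.
Context {R : realType} (n : nat) (w : 'I_n -> R).

Definition weight (S : {set 'I_n}) : R := \sum_(i in S) w i.

Context {d : measure_display} {Omega : measurableType d}
  (P : probability Omega R) (v : 'I_n -> {RV P >-> R}).

Definition profit (S : {set 'I_n}) (x : Omega) : R := \sum_(i in S) v i x.

Definition mutually_independent : Prop :=
  forall (J : {set 'I_n}) (A : 'I_n -> set R),
    (forall i, measurable (A i)) ->
    P (\bigcap_(i in [set` J]) (v i @^-1` A i)) =
    (\prod_(i in J) P (v i @^-1` A i))%E.

(* The empty set is feasible and probabilities are nonnegative, so the default
   value 0 of the maximum is harmless. *)
Definition OPT (T : R) : \bar R :=
  \big[maxe/0%E]_(S : {set 'I_n} | weight S <= 1)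
     P [set x | T <= profit S x].

(* For a complex number phi = e^(a + i b), we have |phi| <= 1 iff a <= 0, and
   phi^v stands for e^((a + i b) v) = e^(a v) (cos (b v) + i sin (b v)): as v
   need not be an integer, phi is given by one of its logarithms.  The numbers
   E[phi^(v_i)] are computable in the sense that they can be approximated to
   any prescribed accuracy delta > 0; exact values are a special case. *)
Definition computes_transforms (q : oracle R) : Prop :=
  forall (i : 'I_n) (a b delta : R), a <= 0 -> 0 < delta ->
    (`|(q i a b delta).1%:E
       - 'E_P[fun x => (expR (a * v i x) * cos (b * v i x))%R]| <= delta%:E)%E /\
    (`|(q i a b delta).2%:E
       - 'E_P[fun x => (expR (a * v i x) * sin (b * v i x))%R]| <= delta%:E)%E.

End Knapsack.

(* Input: n is in position 0 of array 0 of the natural-number memory, w_i in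
   position i of array 0 of the real memory, T in position 0 of its array 1.
   All other cells contain 0. *)
Definition input (R : realType) (n : nat) (w : 'I_n -> R) (T : R) : state R :=
  State
    (fun x j => if (x == 0%N) && (j == 0%N) then n else 0%N)
    (fun x j =>
       (if x == 0%N then (if insub j is Some i then w i else 0)
        else if (x == 1%N) && (j == 0%N) then T else 0, 1%N)).

(* Output: item i is selected iff position i of array 1 of the natural-number
   memory is nonzero. *)
Definition output (R : realType) (n : nat) (s : state R) : {set 'I_n} :=
  [set i : 'I_n | nmem s 1%N i != 0%N]%SET.

(* Main.v *)
(* The event [v(S) >= T] is replaced by the smooth utility
   [E ((1 - e^(- A v(S) / T)) ^ L)], where [A] is a large integer and [L] is
   about [theta e^A]: the function [y |-> (1 - e^(- A y)) ^ L] is at least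
   [1 - theta] for [y >= 1] and at most [theta] for [0 <= y <= 1 - eps], so the
   utility lies between [(1 - theta) P (v(S) >= T)] and
   [P (v(S) > (1 - eps) T) + theta].
   By the binomial formula and independence, the utility of [S] is the sum over
   [j <= L] of [(-1)^j C(L, j)] times the product over the items [i] of [S] of
   [E (e^(- j A v_i / T))].  It is thus determined by [L + 1] products, which a
   dynamic program tracks, item after item, rounded to multiples of [1 / N]
   with [N = K (n + 1)]: multiplying by a number of [[0, 1]] does not amplify
   errors, so they stay below [2 n / N], while there are only [(N + 1)^(L + 1)]
   vectors of rounded values.  For each vector the table remembers a set of
   least weight producing it, so that even the capacity 1 is respected. *)
Require Import Defs.
From HB Require Import structures.
From mathcomp Require Import all_boot all_order all_algebra.
From mathcomp Require Import all_classical all_reals all_analysis.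
From mathcomp Require Import measurable_realfun.
From mathcomp Require Import zify ring lra.

Set Implicit Arguments.
Unset Strict Implicit.
Unset Printing Implicit Defensive.

Import Order.TTheory GRing.Theory Num.Theory.

Local Open Scope classical_set_scope.
Local Open Scope ring_scope.

(** * Values, costs and total correctness of programs *)

Lemma bitlenP k : (k < 2 ^ bitlen k)%N.
Proof. exact: trunc_log_ltn. Qed.

Lemma bitlen_le k b : (0 < b)%N -> (k < 2 ^ b)%N -> (bitlen k <= b)%N.
Proof.
move=> b0 kb; case: (posnP k) => [->|k0]; first by rewrite /bitlen trunc_log0.
rewrite /bitlen -(ltn_exp2l _ _ (isT : (1 < 2)%N)).
exact: leq_ltn_trans (trunc_logP _ _) kb.
Qed.

Lemma bitlen_leq k b : (0 < b)%N -> (k <= b)%N -> (bitlen k <= b)%N.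
Proof.
move=> b0 kb; apply: bitlen_le => //.
exact: leq_ltn_trans kb (ltn_expl _ _).
Qed.

(** Each power [2 ^ bitlen k] is at least 2, and two numbers that are at least 2 have a sum bounded
    by their product. Hence addition obeys the same bound as multiplication. *)
Lemma bitlen_napply o k l : (bitlen (napply o k l) <= bitlen k + bitlen l)%N.
Proof.
have p0 m : (0 < 2 ^ bitlen m)%N by rewrite expn_gt0.
apply: bitlen_le => //; rewrite expnD.
have hk := bitlenP k; have hl := bitlenP l.
have h2 m : (2 <= 2 ^ bitlen m)%N by rewrite -[X in (X <= _)%N]expn1 leq_exp2l.
have := h2 k; have := h2 l.
move: (2 ^ bitlen k)%N (2 ^ bitlen l)%N hk hl => x y hk hl hx hy.
case: o => /=.
- nia.
- nia.
- nia.
- apply: leq_ltn_trans (leq_div k l) _; nia.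
Qed.

Section Values.
Context {R : realType}.
Implicit Types s : state R.

(** Values and lengths are separated from costs: the former are computed exactly in the proofs
    below, the latter are only bounded. *)
Fixpoint nval s (e : nexp) : nat :=
  match e with
  | NCst k => k
  | NGet x e1 => nmem s x (nval s e1)
  | NOp o e1 e2 => napply o (nval s e1) (nval s e2)
  end.

Fixpoint rval s (e : rexp) : R :=
  match e with
  | RNat e1 => (nval s e1)%:R
  | RGet x e1 => (rmem s x (nval s e1)).1
  | ROp o e1 e2 => rapply o (rval s e1) (rval s e2)
  end.

Fixpoint rlen s (e : rexp) : nat :=
  match e with
  | RNat e1 => bitlen (nval s e1)
  | RGet x e1 => (rmem s x (nval s e1)).2
  | ROp o e1 e2 => (rlen s e1 + rlen s e2).+1
  end.

Fixpoint test_val s (t : test) : bool :=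
  match t with
  | NLe e1 e2 => (nval s e1 <= nval s e2)%N
  | RLe e1 e2 => rval s e1 <= rval s e2
  | TNot t1 => ~~ test_val s t1
  end.

Lemma neval_fst s e : (neval s e).1 = nval s e.
Proof.
elim: e => [k|x e IH|o e1 IH1 e2 IH2] //=.
  by case: (neval s e) IH => i c /= ->.
by case: (neval s e1) IH1 => ? ? /= ->; case: (neval s e2) IH2 => ? ? /= ->.
Qed.

Lemma nevalE s e : neval s e = (nval s e, (neval s e).2).
Proof. by rewrite -neval_fst; case: (neval s e). Qed.

Lemma reval_fst s e : (reval s e).1 = (rval s e, rlen s e).
Proof.
elim: e => [e|x e|o e1 IH1 e2 IH2] /=; first by rewrite nevalE.
  by rewrite (nevalE s e) /=; case: (rmem s x _).
by case: (reval s e1) IH1 => [[? ?] ?] /= [-> ->];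
  case: (reval s e2) IH2 => [[? ?] ?] /= [-> ->].
Qed.

Lemma revalE s e : reval s e = ((rval s e, rlen s e), (reval s e).2).
Proof. by rewrite -reval_fst; case: (reval s e). Qed.

Lemma teval_fst s t : (teval s t).1 = test_val s t.
Proof.
elim: t => [e1 e2|e1 e2|t IH] /=; first by rewrite (nevalE s e1) (nevalE s e2).
  by rewrite (revalE s e1) (revalE s e2).
by case: (teval s t) IH => ? ? /= ->.
Qed.

Lemma tevalE s t : teval s t = (test_val s t, (teval s t).2).
Proof. by rewrite -teval_fst; case: (teval s t). Qed.

Lemma nval_get s x e : nval s (NGet x e) = nmem s x (nval s e).
Proof. by []. Qed.

Lemma nval_op s o e1 e2 : nval s (NOp o e1 e2) = napply o (nval s e1) (nval s e2).
Proof. by []. Qed.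

Lemma rval_get s x e : rval s (RGet x e) = (rmem s x (nval s e)).1.
Proof. by []. Qed.

Lemma rval_op s o e1 e2 : rval s (ROp o e1 e2) = rapply o (rval s e1) (rval s e2).
Proof. by []. Qed.

Lemma rlen_get s x e : rlen s (RGet x e) = (rmem s x (nval s e)).2.
Proof. by []. Qed.

Lemma rlen_op s o e1 e2 : rlen s (ROp o e1 e2) = (rlen s e1 + rlen s e2).+1.
Proof. by []. Qed.

Lemma test_val_nle s e1 e2 : test_val s (NLe e1 e2) = (nval s e1 <= nval s e2)%N.
Proof. by []. Qed.

Lemma test_val_rle s e1 e2 : test_val s (RLe e1 e2) = (rval s e1 <= rval s e2).
Proof. by []. Qed.

End Values.

Local Open Scope nat_scope.

(** A syntactic coefficient: when every cell has length at most [b], the value of [e] has length at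
    most [nsz e * b] and its evaluation costs at most [nsz e ^ 2 * b]. The functions [rsz] and [tsz]
    play the same role for reals and tests. *)
Fixpoint nsz (e : nexp) : nat :=
  match e with
  | NCst k => bitlen k
  | NGet x e1 => (nsz e1).+1
  | NOp o e1 e2 => nsz e1 + nsz e2
  end.

Fixpoint rsz (e : rexp) : nat :=
  match e with
  | RNat e1 => (nsz e1).+1
  | RGet x e1 => (nsz e1).+1
  | ROp o e1 e2 => (rsz e1 + rsz e2).+1
  end.

Fixpoint tsz (t : test) : nat :=
  match t with
  | NLe e1 e2 => (nsz e1 + nsz e2).+1
  | RLe e1 e2 => (rsz e1 + rsz e2).+1
  | TNot t1 => (tsz t1).+1
  end.

(* Bounds the cost of a run during which every cell has length at most [b] and
   every loop makes at most [b] iterations. *)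
Fixpoint csz (b : nat) (p : cmd) : nat :=
  match p with
  | Skip => 1
  | Then p1 p2 => (csz b p1 + csz b p2).+1
  | NSet x e1 e2 => (nsz e1 + nsz e2).+1 ^ 2 * b
  | RSet x e1 e2 => (nsz e1 + rsz e2).+1 ^ 2 * b
  | Query x e ea eb ed => (nsz e + rsz ea + rsz eb + rsz ed).+1 ^ 2 * b
  | If t p1 p2 => (tsz t ^ 2 * b + (csz b p1 + csz b p2)).+1
  | While t p1 => (b.+1 * (tsz t ^ 2 * b + csz b p1).+1)%N
  end.

(** Only loops multiply the bound, by [b + 1], so the degree depends on the program text alone. A
    single [K] is both coefficient and exponent, so that the bounds of subprograms can simply be
    added. *)
Lemma csz_poly p : exists K, forall b, (csz b p <= K * b.+1 ^ K)%N.
Proof.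
have up x K K' b : (K <= K' -> x * b.+1 ^ K <= x * b.+1 ^ K')%N.
  by move=> h; rewrite leq_mul2l leq_pexp2l ?orbT.
have lin x b K : (0 < K -> x * b <= x * b.+1 ^ K)%N.
  move=> K0; rewrite leq_mul2l; apply/orP; right.
  by apply: leq_trans (leqnSn b) _; rewrite -[X in (X <= _)%N]expn1 leq_pexp2l.
have one b K : (1 <= b.+1 ^ K)%N by rewrite expn_gt0.
elim: p => [|p1 [K1 H1] p2 [K2 H2]|x e1 e2|x e1 e2|x e ea eb ed
  |t p1 [K1 H1] p2 [K2 H2]|t p [K H]].
- by exists 1%N => b; rewrite mul1n expn1.
- exists (K1 + K2).+1 => b /=.
  have h1 := leq_trans (H1 b) (up K1 K1 (K1 + K2).+1 b ltac:(lia)).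
  have h2 := leq_trans (H2 b) (up K2 K2 (K1 + K2).+1 b ltac:(lia)).
  have := one b (K1 + K2).+1; lia.
- exists ((nsz e1 + nsz e2).+1 ^ 2).+1 => b /=.
  by apply: leq_trans (lin _ b _.+1 isT) (leq_mul (leqnSn _) (leqnn _)).
- exists ((nsz e1 + rsz e2).+1 ^ 2).+1 => b /=.
  by apply: leq_trans (lin _ b _.+1 isT) (leq_mul (leqnSn _) (leqnn _)).
- exists ((nsz e + rsz ea + rsz eb + rsz ed).+1 ^ 2).+1 => b /=.
  by apply: leq_trans (lin _ b _.+1 isT) (leq_mul (leqnSn _) (leqnn _)).
- exists (tsz t ^ 2 + K1 + K2).+1 => b /=.
  have h1 := leq_trans (H1 b) (up K1 K1 (tsz t ^ 2 + K1 + K2).+1 b ltac:(lia)).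
  have h2 := leq_trans (H2 b) (up K2 K2 (tsz t ^ 2 + K1 + K2).+1 b ltac:(lia)).
  have := one b (tsz t ^ 2 + K1 + K2).+1.
  have := @lin (tsz t ^ 2)%N b (tsz t ^ 2 + K1 + K2).+1 isT; lia.
- exists (tsz t ^ 2 + K).+2 => b /=.
  have h1 := leq_trans (H b) (up K K (tsz t ^ 2 + K).+1 b ltac:(lia)).
  have := one b (tsz t ^ 2 + K).+1.
  have := @lin (tsz t ^ 2)%N b (tsz t ^ 2 + K).+1 isT.
  move=> h2 h3.
  rewrite [X in (_ <= _ * X)%N]expnS mulnCA leq_mul2l /=.
  lia.
Qed.

(** * Proof rules for total correctness within a cost bound *)

Section WP.
Context {R : realType} (q : oracle R) (b : nat).
Hypothesis b_gt0 : (0 < b)%N.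
Implicit Types (s : state R) (Q : state R -> Prop).

Definition small s := forall x i,
  (bitlen (nmem s x i) <= b)%N /\ ((rmem s x i).2 <= b)%N.

Lemma small_nval s e : small s -> (bitlen (nval s e) <= nsz e * b)%N.
Proof.
move=> sm; elim: e => [k|x e IH|o e1 IH1 e2 IH2] /=.
- by rewrite leq_pmulr.
- by apply: leq_trans (sm x _).1 _; rewrite leq_pmull.
- by apply: leq_trans (bitlen_napply _ _ _) _; rewrite mulnDl leq_add.
Qed.

Lemma nsz_gt0 e : (0 < nsz e)%N.
Proof. by elim: e => //= o e1 IH1 e2 IH2; rewrite addn_gt0 IH1. Qed.

Lemma small_ncost s e : small s -> ((neval s e).2 <= nsz e ^ 2 * b)%N.
Proof.
move=> sm; elim: e => [k|x e IH|o e1 IH1 e2 IH2] /=.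
- by rewrite -[X in X <= _]muln1 leq_mul // expnS leq_pmulr.
- rewrite (nevalE s e) /=; have := (sm x (nval s e)).1; move: IH => /=; nia.
- rewrite (nevalE s e1) (nevalE s e2) /=.
  have := leq_trans (bitlen_napply o (nval s e1) (nval s e2))
    (leq_add (small_nval e1 sm) (small_nval e2 sm)).
  have := nsz_gt0 e1; have := nsz_gt0 e2; move: IH1 IH2.
  move: (nsz e1) (nsz e2) (bitlen _) (neval _ _).2 (neval _ _).2 => x y t c d.
  move=> h1 h2 y0 x0 h; apply: (@leq_trans (x ^ 2 * b + y ^ 2 * b + (x * b + y * b))%N).
    by rewrite !leq_add.
  rewrite -!mulnDl leq_mul2r; apply/orP; right; nia.
Qed.

Lemma small_rlen s e : small s -> (rlen s e <= rsz e * b)%N.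
Proof.
move=> sm; elim: e => [e|x e|o e1 IH1 e2 IH2] /=.
- by apply: leq_trans (small_nval e sm) _; rewrite leq_mul2r leqnSn orbT.
- by apply: leq_trans (sm x _).2 _; rewrite leq_pmull.
- by rewrite mulSn mulnDl -add1n !leq_add.
Qed.

Lemma small_rcost s e : small s -> ((reval s e).2 <= rsz e ^ 2 * b)%N.
Proof.
move=> sm; elim: e => [e|x e|o e1 IH1 e2 IH2] /=.
- rewrite (nevalE s e) /=; have := small_nval e sm; have := small_ncost e sm; nia.
- rewrite (nevalE s e) /=; have := (sm x (nval s e)).2; have := small_ncost e sm; nia.
- rewrite (revalE s e1) (revalE s e2) /=.
  have := small_rlen e1 sm; have := small_rlen e2 sm; move: IH1 IH2.
  move: (rsz e1) (rsz e2) (rlen _ _) (rlen _ _) (reval _ _).2 (reval _ _).2.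
  move=> x y t u c d h1 h2 hx hy.
  apply: (@leq_trans (x ^ 2 * b + y ^ 2 * b + (x * b + y * b).+1)%N); first lia.
  apply: (@leq_trans ((x ^ 2 + y ^ 2 + x + y + 1) * b)%N); first nia.
  rewrite leq_mul2r; apply/orP; right; nia.
Qed.

Lemma small_tcost s t : small s -> ((teval s t).2 <= tsz t ^ 2 * b)%N.
Proof.
move=> sm; elim: t => [e1 e2|e1 e2|t IH] /=.
- rewrite (nevalE s e1) (nevalE s e2) /=; have := small_ncost e1 sm; have := small_ncost e2 sm.
  move: (neval _ _).2 (neval _ _).2 (nsz e1) (nsz e2) => c d x y h1 h2.
  apply: (@leq_trans ((y ^ 2 + x ^ 2 + 1) * b)%N); first nia.
  rewrite leq_mul2r; apply/orP; right; nia.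
- rewrite (revalE s e1) (revalE s e2) /=; have := small_rcost e1 sm; have := small_rcost e2 sm.
  move: (reval _ _).2 (reval _ _).2 (rsz e1) (rsz e2) => c d x y h1 h2.
  apply: (@leq_trans ((y ^ 2 + x ^ 2 + 1) * b)%N); first nia.
  rewrite leq_mul2r; apply/orP; right; nia.
- rewrite (tevalE s t) /=; move: IH; move: (teval _ _).2 (tsz t) => c x h; nia.
Qed.

(** A weakest precondition that carries termination, cost and smallness along implicitly. The rules
    below then ask only for the functional property and, at each write, for the length of the value
    written. *)
Definition wp (p : cmd) Q s := small s -> exists s' c,
  [/\ exec q p s s' c, (c <= csz b p)%N, small s' & Q s'].

Lemma wp_weaken p (Q Q' : state R -> Prop) s :
  wp p Q s -> (forall s', Q s' -> Q' s') -> wp p Q' s.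
Proof.
by move=> H QQ' /H [s' [c [? ? ? /QQ' ?]]]; exists s', c.
Qed.

Lemma wp_skip Q s : Q s -> wp Skip Q s.
Proof. by move=> Qs sm; exists s, 1%N; split => //; exact: ExecSkip. Qed.

Lemma wp_then p1 p2 Q s : wp p1 (wp p2 Q) s -> wp (Then p1 p2) Q s.
Proof.
move=> H1 /H1 [s1 [c1 [e1 l1 sm1 H2]]].
have [s2 [c2 [e2 l2 sm2 Qs]]] := H2 sm1.
exists s2, (c1 + c2).+1; split => //=; first exact: ExecThen e1 e2.
by rewrite ltnS leq_add.
Qed.

Definition nset s x i k := State (write (nmem s) x i k) (rmem s).
Definition rset s x i a := State (nmem s) (write (rmem s) x i a).

Lemma small_nset s x i k : small s -> (bitlen k <= b)%N -> small (nset s x i k).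
Proof.
by move=> sm kb y j; split; rewrite /= ?(sm y j).2 // /write;
  case: ifP => // _; exact: (sm y j).1.
Qed.

Lemma small_rset s x i a : small s -> (a.2 <= b)%N -> small (rset s x i a).
Proof.
by move=> sm ab y j; split; rewrite /= ?(sm y j).1 // /write;
  case: ifP => // _; exact: (sm y j).2.
Qed.

Lemma wp_nset x e1 e2 Q s :
  (small s -> (bitlen (nval s e2) <= b)%N) -> Q (nset s x (nval s e1) (nval s e2)) ->
  wp (NSet x e1 e2) Q s.
Proof.
move=> le Qs sm; exists (nset s x (nval s e1) (nval s e2)), ((neval s e1).2 + (neval s e2).2).+1.
split=> //; last by apply: small_nset => //; exact: le.
  by apply: ExecNSet; exact: nevalE.
have := small_ncost e1 sm; have := small_ncost e2 sm => /=.
move: (nsz e1) (nsz e2) (neval _ _).2 (neval _ _).2 => y z c d h1 h2.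
apply: (@leq_trans ((y ^ 2 + z ^ 2 + 1) * b)%N); first nia.
rewrite leq_mul2r; apply/orP; right; nia.
Qed.

Lemma wp_rset x e1 e2 Q s :
  (small s -> (rlen s e2 <= b)%N) ->
  Q (rset s x (nval s e1) (rval s e2, rlen s e2)) ->
  wp (RSet x e1 e2) Q s.
Proof.
move=> le Qs sm.
exists (rset s x (nval s e1) (rval s e2, rlen s e2)), ((neval s e1).2 + (reval s e2).2).+1.
split=> //; last by apply: small_rset => //; exact: le.
  by apply: ExecRSet; [exact: nevalE|exact: revalE].
have := small_ncost e1 sm; have := small_rcost e2 sm => /=.
move: (nsz e1) (rsz e2) (neval _ _).2 (reval _ _).2 => y z c d h1 h2.
apply: (@leq_trans ((y ^ 2 + z ^ 2 + 1) * b)%N); first nia.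
rewrite leq_mul2r; apply/orP; right; nia.
Qed.

Lemma wp_query x e ea eb ed Q s :
  let l := (rlen s ea + rlen s eb + rlen s ed).+1 in
  let ans := q (nval s e) (rval s ea) (rval s eb) (rval s ed) in
  (l <= b)%N ->
  Q (rset (rset s x 0 (ans.1, l)) x 1 (ans.2, l)) ->
  wp (Query x e ea eb ed) Q s.
Proof.
move=> l ans lb Qs sm.
exists (rset (rset s x 0 (ans.1, l)) x 1 (ans.2, l)).
exists ((neval s e).2 + (reval s ea).2 + (reval s eb).2 + (reval s ed).2 + l)%N.
split=> //.
- by apply: ExecQuery; [exact: nevalE|exact: revalE..].
- have := small_ncost e sm; have := small_rcost ea sm.
  have := small_rcost eb sm; have := small_rcost ed sm => /=.
  move: (nsz e) (rsz ea) (rsz eb) (rsz ed) (neval _ _).2 (reval _ _).2 (reval _ _).2 (reval _ _).2.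
  move=> y z t u c1 c2 c3 c4 h1 h2 h3 h4.
  apply: (@leq_trans ((y ^ 2 + z ^ 2 + t ^ 2 + u ^ 2 + 1) * b)%N); first lia.
  rewrite leq_mul2r; apply/orP; right; nia.
- by do 2 apply: small_rset => //.
Qed.

Lemma wp_if t p1 p2 Q s :
  (test_val s t -> wp p1 Q s) -> (~~ test_val s t -> wp p2 Q s) -> wp (If t p1 p2) Q s.
Proof.
move=> H1 H2 sm; have ct := small_tcost t sm.
case E: (test_val s t).
  have [s' [c [e l sm' Qs]]] := H1 E sm.
  exists s', ((teval s t).2 + c).+1; split => //=; last by lia.
  by apply: ExecIfTrue e; rewrite tevalE E.
have [s' [c [e l sm' Qs]]] := H2 (negbT E) sm.
exists s', ((teval s t).2 + c).+1; split => //=; last by lia.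
by apply: ExecIfFalse e; rewrite tevalE E.
Qed.

Definition For (x : nat) (e : nexp) (p : cmd) : cmd :=
  Then (NSet x (NCst 0) (NCst 0))
    (While (TNot (NLe e (NGet x (NCst 0))))
       (Then p (NSet x (NCst 0) (NOp NAdd (NGet x (NCst 0)) (NCst 1))))).

(** The bound [e] is reevaluated at each iteration, so the invariant has to fix its value [m]; the
    body must leave the counter alone. The condition [m <= b] makes the number of iterations fit the
    bound that [csz] grants to a loop. *)
Lemma wp_for x e p m (I : nat -> state R -> Prop) Q s :
  (m <= b)%N ->
  (forall k s, nmem s x 0 = k -> I k s -> nval s e = m) ->
  I 0%N (nset s x 0 0) ->
  (forall k s, (k < m)%N -> nmem s x 0 = k -> I k s ->
    wp p (fun s' => nmem s' x 0 = k /\ I k.+1 (nset s' x 0 k.+1)) s) ->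
  (forall s, I m s -> Q s) ->
  wp (For x e p) Q s.
Proof.
move=> mb He I0 Ip IQ; apply: wp_then; apply: wp_nset => /=.
  by move=> _; rewrite bitlen_leq.
set t := TNot _; set p' := Then p _.
(* Induction on the number [d] of iterations left; the extra unit in [d.+1] pays for the last,
   failing test. *)
suff loop d k s1 : (k + d = m)%N -> small s1 -> nmem s1 x 0 = k -> I k s1 ->
    exists s2 c, [/\ exec q (While t p') s1 s2 c,
      (c <= d.+1 * (tsz t ^ 2 * b + csz b p').+1)%N, small s2 & Q s2].
  move=> sm; have [] := loop m 0%N _ (erefl m) sm _ I0.
    by rewrite /= /write !eqxx.
  move=> s2 [c [ex le sm2 Qs2]]; exists s2, c; split => //.
  by apply: leq_trans le _; rewrite leq_mul2r; apply/orP; right.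
elim: d k s1 => [|d IH] k s1 kd sm xk Ik; have ct := small_tcost t sm.
  exists s1, (teval s1 t).2.+1; split => //; last 1 first.
  - by apply: IQ; rewrite -kd addn0.
  - by apply: ExecWhileFalse; rewrite tevalE /= (He k) // xk -kd addn0 leqnn.
  - by rewrite mul1n ltnS (leq_trans ct) // leq_addr.
have km : (k < m)%N by lia.
have : wp p' (fun s' => nmem s' x 0 = k.+1 /\ I k.+1 s') s1.
  apply: wp_then; apply: (wp_weaken (Ip _ _ km xk Ik)) => s' [xk' Ik'].
  apply: wp_nset => /=; rewrite xk' addn1; first by rewrite bitlen_leq //; lia.
  by split => //; rewrite /= /write !eqxx.
case/(_ sm) => s2 [c1 [ex1 le1 sm2 [xk2 Ik2]]].
have [|s3 [c2 [ex2 le2 sm3 Qs3]]] := IH _ _ _ sm2 xk2 Ik2; first by lia.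
exists s3, ((teval s1 t).2 + c1 + c2).+1; split => //.
- by apply: ExecWhileTrue ex1 ex2; rewrite tevalE /= (He k) // xk -ltnNge km.
- by rewrite [X in (_ <= X)%N]mulSn; lia.
Qed.

End WP.

(** * The program *)

Local Notation reg x := (NGet x (NCst 0)).
Local Notation "p1 ;; p2" := (Then p1 p2) (at level 70, right associativity).
Local Notation "x <- e" := (NSet x (NCst 0) e) (at level 65).
Local Notation nadd := (NOp NAdd).
Local Notation nsub := (NOp NSub).
Local Notation nmul := (NOp NMul).
Local Notation ndiv := (NOp NDiv).

(* Natural-number registers: 2 the base [B], 3 the number [M = B ^ L.+1] of
   codes, 4 the item, 5 the code, 6 the coordinate, 7 the candidate for the
   rounded value, 8 the digit, 9 its rounded image, 10 the new code, 11 the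
   current power of [B], 12 the best code, 13 the mask being decoded.
   Array 14 holds the masks and the real array 2 the weights of the cells of
   the table, the cell of layer [l] and code [c] being at position [l * M + c].
   A mask is the list of the decisions taken, in binary after a leading 1; it
   is 0 on the cells not reached. *)
Definition cell (l c : nexp) : nexp := nadd (nmul l (reg 3)) c.

(** With [p] a power of [B], this is a digit of [c] in base [B]; the remainder is obtained from
    division, product and subtraction. *)
Definition digit_exp (c p : nexp) : nexp :=
  nsub (ndiv c p) (nmul (reg 2) (ndiv (ndiv c p) (reg 2))).

Fixpoint pow_exp (k : nat) : nexp :=
  if k is k'.+1 then nmul (pow_exp k') (reg 2) else NCst 1.

Section Program.
Variables (A L K : nat).

(** The alternating binomial sum of the digits of a code, unrolled in the syntax: [L] is fixed with
    the program, so the binomial coefficients are constants. *)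
Fixpoint score_exp (c : nexp) (k : nat) : rexp :=
  if k is k'.+1 then
    ROp (if odd k' then RSub else RAdd) (score_exp c k')
      (RNat (nmul (NCst 'C(L, k')) (digit_exp c (pow_exp k'))))
  else RNat (NCst 0).

(** Layer 0 has one reached cell, of code [M - 1]: all its digits are [B - 1 = N], the rounded form
    of the empty product 1. Its mask 1 is the empty list of decisions. *)
Definition init_prog : cmd :=
  2 <- nadd (nmul (NCst K) (nadd (reg 0) (NCst 1))) (NCst 1) ;;
  3 <- pow_exp L.+1 ;;
  NSet 14 (nsub (reg 3) (NCst 1)) (NCst 1).

(** As reals cannot be converted to natural numbers, the rounded product is found by trying all
    candidates up to the current digit. *)
Definition round_prog : cmd :=
  9 <- NCst 0 ;;
  For 7 (reg 8)
    (If (RLe (RNat (nadd (reg 7) (NCst 1)))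
             (ROp RMul (RNat (reg 8)) (RGet 3 (NCst 0))))
        (9 <- nadd (reg 7) (NCst 1)) Skip).

(** The query asks for [E (e^(- j A v_i / T))] with accuracy [1 / B]; the imaginary exponent is 0,
    and only the real part of the answer is used. *)
Definition query_prog : cmd :=
  Query 3 (reg 4)
    (ROp RDiv (ROp RSub (RNat (NCst 0)) (RNat (nmul (NCst A) (reg 6))))
              (RGet 1 (NCst 0)))
    (RNat (NCst 0)) (ROp RDiv (RNat (NCst 1)) (RNat (reg 2))).

Definition step_prog : cmd :=
  10 <- NCst 0 ;;
  11 <- NCst 1 ;;
  For 6 (NCst L.+1)
    (8 <- digit_exp (reg 5) (reg 11) ;;
     query_prog ;;
     round_prog ;;
     10 <- nadd (reg 10) (nmul (reg 9) (reg 11)) ;;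
     11 <- nmul (reg 11) (reg 2)).

(** Dominance: of two sets with the same code, the lighter one is kept. *)
Definition relax_prog (c mask : nexp) (wgt : rexp) : cmd :=
  let t := cell (nadd (reg 4) (NCst 1)) c in
  let update := RSet 2 t wgt ;; NSet 14 t mask in
  If (NLe (NCst 1) (NGet 14 t)) (If (RLe (RGet 2 t) wgt) Skip update) update.

Definition table_prog : cmd :=
  let t := cell (reg 4) (reg 5) in
  For 4 (reg 0) (For 5 (reg 3) (If (NLe (NCst 1) (NGet 14 t))
    (relax_prog (reg 5) (nmul (NCst 2) (NGet 14 t)) (RGet 2 t) ;;
     step_prog ;;
     relax_prog (reg 10) (nadd (nmul (NCst 2) (NGet 14 t)) (NCst 1))
       (ROp RAdd (RGet 2 t) (RGet 0 (reg 4))))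
    Skip)).

(** The search starts from the code of the empty set, whose cell is reached and within capacity. *)
Definition select_prog : cmd :=
  let t := cell (reg 0) (reg 5) in
  12 <- nsub (reg 3) (NCst 1) ;;
  For 5 (reg 3) (If (NLe (NCst 1) (NGet 14 t)) (If (RLe (RGet 2 t) (RNat (NCst 1)))
    (If (RLe (score_exp (reg 12) L.+1) (score_exp (reg 5) L.+1))
        (12 <- reg 5) Skip) Skip) Skip).

(** The lowest bit of a mask is the latest decision, so the items are recovered from the last to the
    first. *)
Definition decode_prog : cmd :=
  13 <- NGet 14 (cell (reg 0) (reg 12)) ;;
  For 4 (reg 0)
    (NSet 1 (nsub (reg 0) (nadd (reg 4) (NCst 1)))
            (nsub (reg 13) (nmul (NCst 2) (ndiv (reg 13) (NCst 2)))) ;;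
     13 <- ndiv (reg 13) (NCst 2)).

Definition knapsack_prog : cmd :=
  init_prog ;; table_prog ;; select_prog ;; decode_prog.

End Program.

(** * Vectors of rounded values as numbers in base [B] *)

Section Digits.
Variable B : nat.
Hypothesis B_gt0 : 0 < B.

Definition digit (j c : nat) : nat := c %/ B ^ j %% B.

Lemma digit_lt j c : digit j c < B.
Proof. exact: ltn_pmod. Qed.

Lemma sum_digits_lt k (f : nat -> nat) : (forall j, f j < B) ->
  \sum_(j < k) f j * B ^ j < B ^ k.
Proof.
move=> fB; elim: k => [|k IH]; first by rewrite big_ord0.
rewrite big_ord_recr /= expnS; have := fB k; have := expn_gt0 B k.
rewrite B_gt0 /=; move: IH; move: (\sum_(_ < _) _) (B ^ k) => x y; nia.
Qed.

(** The terms below rank [j] sum to less than [B ^ j] and vanish in the quotient; those above are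
    multiples of [B ^ j.+1] and vanish modulo [B]. *)
Lemma digit_sum k (f : nat -> nat) j : (forall j, f j < B) -> j < k ->
  digit j (\sum_(i < k) f i * B ^ i) = f j.
Proof.
move=> fB jk; rewrite -(subnKC jk) addSnnS big_split_ord /=.
rewrite [X in _ + X](_ : _ =
    (\sum_(i < k - j.+1) f (j + i.+1) * B ^ i * B + f j) * B ^ j); last first.
  rewrite big_ord_recl /= addn0 addnC mulnDl; congr (_ + _).
  rewrite big_distrl /=; apply: eq_bigr => i _.
  by rewrite -!mulnA -expnS -expnD /bump /= add1n addnS addnC addnS.
rewrite /digit addnC divnMDl ?expn_gt0 ?B_gt0 // divn_small ?addn0; last first.
  exact: sum_digits_lt.
by rewrite -big_distrl /= modnMDl modn_small.
Qed.

Lemma digit_predn k j : j < k -> digit j (B ^ k).-1 = B.-1.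
Proof.
move=> jk; rewrite -(@digit_sum k (fun=> B.-1) j) //; last by move=> _; rewrite prednK.
congr digit; apply: succn_inj; rewrite prednK ?expn_gt0 ?B_gt0 // {jk}.
elim: k => [|k IH]; first by rewrite big_ord0.
by rewrite big_ord_recr /= -addSn -IH expnS -mulSn prednK.
Qed.

End Digits.

(** * The table computed by the program *)

Local Arguments bitlen : simpl never.

Section Memory.
Context {R : realType}.
Implicit Types s : state R.

Lemma write_eq (V : Type) (m : nat -> nat -> V) x i a : write m x i a x i = a.
Proof. by rewrite /write !eqxx. Qed.

Lemma write_neq (V : Type) (m : nat -> nat -> V) x i a y : y != x ->
  write m x i a y = m y.
Proof. by move=> /negbTE yx; apply/funext => j; rewrite /write yx. Qed.

Lemma write_neq_pos (V : Type) (m : nat -> nat -> V) x i a j : j != i ->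
  write m x i a x j = m x j.
Proof. by move=> /negbTE ji; rewrite /write ji andbF. Qed.

Definition same (xs ys : seq nat) s s' :=
  (forall x, x \notin xs -> nmem s' x = nmem s x) /\
  (forall y, y \notin ys -> rmem s' y = rmem s y).

Lemma same_trans xs' ys' xs ys s0 s s' :
  same xs ys s0 s -> same xs' ys' s s' -> all (mem xs) xs' -> all (mem ys) ys' ->
  same xs ys s0 s'.
Proof.
move=> [h1 h2] [h1' h2'] /allP xx /allP yy; split=> x nx.
  by rewrite h1' ?h1 //; apply: contra nx => /xx.
by rewrite h2' ?h2 //; apply: contra nx => /yy.
Qed.

Lemma same_nset xs ys s0 s x i k : x \in xs -> same xs ys s0 s ->
  same xs ys s0 (nset s x i k).
Proof.
move=> xx [h1 h2]; split=> // y ny; rewrite /= write_neq ?h1 //.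
by apply: contraNneq ny => ->.
Qed.

Lemma same_rset xs ys s0 s x i a : x \in ys -> same xs ys s0 s ->
  same xs ys s0 (rset s x i a).
Proof.
move=> xx [h1 h2]; split=> // y ny; rewrite /= write_neq ?h2 //.
by apply: contraNneq ny => ->.
Qed.

End Memory.

(** For [y >= 0], the floor of [y] capped at [g]; the recursion follows the loop of [round_prog].
    The cap keeps the result a valid digit whatever the oracle answers. *)
Fixpoint grid_round (R : realType) (g : nat) (y : R) : nat :=
  if g is g'.+1 then if (g%:R <= y)%R then g else grid_round g' y else 0.

Lemma grid_round_le (R : realType) g (y : R) : grid_round g y <= g.
Proof. by elim: g => //= g IH; case: ifP => // _; exact: leqW. Qed.

(** * Correctness of the successive phases of the program *)

Section Semantics.
Context {R : realType} (q : oracle R) (A L K n b : nat) (T : R) (wt : nat -> R).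

Implicit Types s : state R.

Let B := (K * n.+1).+1.
Let M := B ^ L.+1.

(** Here [M] covers the codes and the sweep of a layer, [2 * n] the masks and the lengths of
    weights, [A * L] and [B] the arguments of queries. *)
Hypothesis b_large : 2 * n + M + B + A * L + L + 20 <= b.

Let b_gt0 : 0 < b. Proof. by move: b_large; rewrite addnS; case: b. Qed.

Let M_gt0 : 0 < M. Proof. by rewrite expn_gt0. Qed.

Let Mb : M <= b. Proof. by move: b_large; move: M => m; lia. Qed.

Let bl k : k <= b -> bitlen k <= b. Proof. exact: bitlen_leq. Qed.

Definition transform_query (i j : nat) : R :=
  (q i ((0%:R - (A * j)%:R) / T)%R 0%:R (1%:R / B%:R)%R).1.

Definition rounded (i c j : nat) : nat :=
  grid_round (digit B j c) ((digit B j c)%:R * transform_query i j)%R.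

Definition next_code (i c : nat) : nat :=
  \sum_(j < L.+1) rounded i c j * B ^ j.

Lemma rounded_lt i c j : rounded i c j < B.
Proof. by apply: leq_ltn_trans (grid_round_le _ _) (digit_lt _ _ _). Qed.

Lemma next_code_lt i c : next_code i c < M.
Proof. by apply: sum_digits_lt => // j; exact: rounded_lt. Qed.

Definition score (c : nat) : R :=
  (\sum_(j < L.+1) (-1) ^+ j * ('C(L, j) * digit B j c)%:R)%R.

Definition env (s : state R) :=
  [/\ nmem s 0 0 = n, nmem s 2 0 = B, nmem s 3 0 = M,
      forall j, rmem s 0 j = (wt j, 1) & rmem s 1 0 = (T, 1)].

Lemma env_same xs ys s s' :
  all [predC xs] [:: 0; 2; 3] -> all [predC ys] [:: 0; 1] ->
  same xs ys s s' -> env s -> env s'.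
Proof.
move=> /= /and4P[x0 x2 x3 _] /and3P[y0 y1 _] [h1 h2] [e1 e2 e3 e4 e5].
by split=> [||| j|]; rewrite ?h1 ?h2.
Qed.

Lemma nval_digit s c p x P : nmem s 2 0 = B -> nval s c = x -> nval s p = P ->
  nval s (digit_exp c p) = x %/ P %% B.
Proof. by move=> eB /= -> ->; rewrite eB {1}(divn_eq (x %/ P) B) mulnC addKn. Qed.

Lemma nval_pow s k : nmem s 2 0 = B -> nval s (pow_exp k) = B ^ k.
Proof. by move=> eB; elim: k => //= k ->; rewrite eB expnSr. Qed.

Lemma rval_score s c x k : nmem s 2 0 = B -> nval s c = x ->
  rval s (score_exp L c k) =
    (\sum_(j < k) (-1) ^+ j * ('C(L, j) * digit B j x)%:R)%R.
Proof.
move=> eB ex; elim: k => [|k IH]; first by rewrite big_ord0.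
rewrite big_ord_recr /= -IH -signr_odd.
have := nval_digit eB ex (nval_pow k eB) => /= ->; rewrite -/(digit B k x).
by case: (odd k); rewrite /= ?expr1 ?expr0 ?mulN1r ?mul1r.
Qed.

Lemma wp_round s g x : nmem s 8 0 = g -> g <= b -> (rmem s 3 0).1 = x ->
  wp q b round_prog
    (fun s' => nmem s' 9 0 = grid_round g (g%:R * x)%R /\ same [:: 7; 9] [::] s s') s.
Proof.
move=> eg gb ex; apply: wp_then; apply: wp_nset => //=.
apply: (@wp_for _ _ _ _ _ _ _ g
  (fun k s' => nmem s' 9 0 = grid_round k (g%:R * x)%R /\ same [:: 7; 9] [::] s s')) => //.
- by move=> k s1 _ [_ [h _]] /=; rewrite h.
- by split; rewrite //=; do 2 apply: same_nset => //.
- move=> k s1 kg ek [e9 h]; have [h1 h2] := h.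
  have e8 : nmem s1 8 0 = g by rewrite h1.
  have e3 : (rmem s1 3 0).1 = x by rewrite h2.
  apply: wp_if => //=; rewrite e8 e3 ek addn1 => le.
    apply: wp_nset => //=; first by move=> _; apply: bl; lia.
    rewrite ek addn1; split; first by rewrite write_neq.
    split; last by do 2 apply: same_nset => //.
    by rewrite write_neq // write_eq le.
  apply: wp_skip; split => //; split; last by apply: same_nset.
  by rewrite /= write_neq // (negbTE le).
Qed.

Lemma wp_query_prog s i j : env s -> nmem s 4 0 = i -> nmem s 6 0 = j -> j <= L ->
  wp q b (query_prog A)
    (fun s' => (rmem s' 3 0).1 = transform_query i j /\ same [::] [:: 3] s s') s.
Proof.
move=> [e0 e2 e3 e4 e5] ei ej jL; apply: wp_query => //=; rewrite ?ei ej e2 e5 /=.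
  have h1 : bitlen (A * j) <= (A * L).+1.
    by apply: bitlen_leq => //; rewrite leqW // leq_mul2l jL orbT.
  have h2 : bitlen B <= B by apply: bitlen_leq.
  move: h1 h2 b_large; rewrite /bitlen !trunc_log0 !trunc_log1; lia.
split; last by do 2 apply: same_rset => //.
by [].
Qed.

Lemma wp_step s i c : env s -> nmem s 4 0 = i -> nmem s 5 0 = c ->
  wp q b (step_prog A L)
    (fun s' => nmem s' 10 0 = next_code i c /\
       same [:: 6; 7; 8; 9; 10; 11] [:: 3] s s') s.
Proof.
move=> env_s ei ec.
apply: wp_then; apply: wp_nset => //=.
apply: wp_then; apply: wp_nset => //=.
apply: (@wp_for _ _ _ _ _ _ _ L.+1
  (fun k s' => [/\ nmem s' 10 0 = \sum_(j < k) rounded i c j * B ^ j,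
     nmem s' 11 0 = B ^ k & same [:: 6; 7; 8; 9; 10; 11] [:: 3] s s'])) => //.
- by move: b_large; lia.
- split; first by rewrite big_ord0 /=.
    by rewrite expn0.
  by do 3 apply: same_nset => //.
- move=> k s1 kL ek [e10 e11 sm]; rewrite ltnS in kL.
  have env1 : env s1 by apply: env_same sm env_s.
  have [e0 e2 e3 e4 e5] := env1.
  have dg : nval s1 (digit_exp (reg 5) (reg 11)) = digit B k c.
    by apply: nval_digit => //=; rewrite sm.1.
  apply: wp_then; apply: wp_nset; rewrite ?dg //.
    by move=> _; apply: bl; have := digit_lt (isT : 0 < B) k c; move: b_large; lia.
  apply: wp_then; set s2 := nset _ _ _ _.
  have sm2 : same [:: 6; 7; 8; 9; 10; 11] [:: 3] s s2 by apply: same_nset.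
  have env2 : env s2 by apply: env_same sm2 env_s.
  apply: wp_weaken (@wp_query_prog s2 i k env2 _ _ kL) _.
  + by rewrite sm2.1.
  + by rewrite /s2 /= write_neq.
  move=> s3 [ex sm3].
  apply: wp_then; apply: wp_weaken (@wp_round s3 (digit B k c) _ _ _ ex) _.
  + by rewrite sm3.1 //= write_eq.
  + by have := digit_lt (isT : 0 < B) k c; move: b_large; lia.
  move=> s4 [e9 sm4]; rewrite -/(rounded i c k) in e9.
  have e10' : nmem s4 10 0 = nmem s1 10 0 by rewrite sm4.1 // sm3.1 //= write_neq.
  have e11' : nmem s4 11 0 = nmem s1 11 0 by rewrite sm4.1 // sm3.1 //= write_neq.
  have e6' : nmem s4 6 0 = nmem s1 6 0 by rewrite sm4.1 // sm3.1 //= write_neq.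
  have e2' : nmem s4 2 0 = nmem s1 2 0 by rewrite sm4.1 // sm3.1 //= write_neq.
  have sm04 : same [:: 6; 7; 8; 9; 10; 11] [:: 3] s s4.
    by exact: same_trans (same_trans sm2 sm3 isT isT) sm4 isT isT.
  have pM : B ^ k.+1 <= M by rewrite leq_pexp2l.
  have sum_lt : \sum_(j < k.+1) rounded i c j * B ^ j < B ^ k.+1.
    by apply: sum_digits_lt => // j; exact: rounded_lt.
  apply: wp_then; apply: wp_nset => //=; rewrite e9 e10' e10 e11' e11.
    rewrite big_ord_recr /= in sum_lt.
    by move=> _; apply: bl; apply: leq_trans (ltnW sum_lt) (leq_trans pM Mb).
  apply: wp_nset => //=; rewrite /write /= e11' e11 e2' e2 -expnSr.
    by move=> _; apply: bl; exact: leq_trans pM Mb.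
  split; first by rewrite e6' ek.
  by split; [rewrite big_ord_recr| |do 3 apply: same_nset => //].
- by move=> s1 [e10 _ sm].
Qed.


(** The code to which the decisions of [S] on the first [l] items lead. Distinct sets may share a
    code. *)
Fixpoint code_of (S : nat -> bool) (l : nat) : nat :=
  if l is l'.+1 then
    if S l' then next_code l' (code_of S l') else code_of S l'
  else M.-1.

Fixpoint mask_of (S : nat -> bool) (l : nat) : nat :=
  if l is l'.+1 then 2 * mask_of S l' + S l' else 1.

Definition weight_of (S : nat -> bool) (l : nat) : R :=
  (\sum_(t < l) if S t then wt t else 0)%R.

Lemma weight_ofS S l :
  weight_of S l.+1 = (weight_of S l + if S l then wt l else 0)%R.
Proof. exact: big_ord_recr. Qed.

Lemma code_of_lt S l : code_of S l < M.
Proof.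
by elim: l => [|l IH] /=; [rewrite prednK|case: ifP => // _; exact: next_code_lt].
Qed.

Lemma mask_of_gt0 S l : 0 < mask_of S l.
Proof. by elim: l => //= l IH; lia. Qed.

Lemma mask_of_bitlen S l : l <= n -> bitlen (mask_of S l) <= b.
Proof.
have h : mask_of S l < 2 ^ l.+1.
  by elim: l => //= l IH; rewrite [2 ^ _]expnS; case: (S l); lia.
move=> ln; apply: bitlen_le => //; apply: leq_trans h _; rewrite leq_exp2l //.
by move: Mb b_large; lia.
Qed.

Lemma mask_of_half S l : mask_of S l.+1 %/ 2 = mask_of S l.
Proof. by rewrite /= mulnC divnMDl // divn_small ?addn0 // ltnS leq_b1. Qed.

Definition extend (S : nat -> bool) (l : nat) (d : bool) (t : nat) : bool :=
  if t == l then d else S t.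

Lemma eq_of S S' l : (forall t, t < l -> S t = S' t) ->
  [/\ code_of S l = code_of S' l, mask_of S l = mask_of S' l &
      weight_of S l = weight_of S' l].
Proof.
elim: l => [|l IH] eS; first by split=> //; rewrite /weight_of !big_ord0.
have [|h1 h2 h3] := IH; first by move=> t tl; rewrite eS // leqW.
rewrite /= h1 h2 eS //; split=> //.
by rewrite !weight_ofS h3 eS.
Qed.

(** The length bound holds because weights are built by adding inputs of length 1, one per selected
    item, and each addition lengthens the cell by 2. *)
Definition witness S l c m (r : R * nat) :=
  [/\ m = mask_of S l, code_of S l = c, r.1 = weight_of S l & r.2 <= l.*2.+1].

Lemma witness_skip S l c m r : witness S l c m r ->
  witness (extend S l false) l.+1 c (2 * m) r.
Proof.
move=> [-> <- er lr]; have [|h1 h2 h3] := @eq_of (extend S l false) S l.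
  by move=> t; rewrite /extend; case: eqP => // ->; rewrite ltnn.
split=> /=.
- by rewrite h2 /extend eqxx addn0.
- by rewrite h1 /extend eqxx.
- by rewrite er weight_ofS h3 /extend eqxx addr0.
- by apply: leq_trans lr _; lia.
Qed.

Lemma witness_take S l c m r : witness S l c m r ->
  witness (extend S l true) l.+1 (next_code l c) (2 * m + 1)
    ((r.1 + wt l)%R, (r.2 + 1).+1).
Proof.
move=> [-> <- er lr]; have [|h1 h2 h3] := @eq_of (extend S l true) S l.
  by move=> t; rewrite /extend; case: eqP => // ->; rewrite ltnn.
split=> /=.
- by rewrite h2 /extend eqxx.
- by rewrite h1 /extend eqxx.
- by rewrite er weight_ofS h3 /extend eqxx.
- by move: lr; lia.
Qed.

(** The two halves of correctness: by [sound] each reached cell describes an actual set; [reach]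
    expresses that a cell holds a weight no larger than a given one, and is later applied to the
    weight of every set with that code. *)
Definition sound s := forall l c, l <= n -> c < M -> nmem s 14 (l * M + c) != 0 ->
  exists S, witness S l c (nmem s 14 (l * M + c)) (rmem s 2 (l * M + c)).

Definition reach s l c (x : R) :=
  nmem s 14 (l * M + c) != 0 /\ ((rmem s 2 (l * M + c)).1 <= x)%R.

Lemma sound_same xs ys s s' : 14 \notin xs -> 2 \notin ys ->
  same xs ys s s' -> sound s -> sound s'.
Proof. by move=> x14 y2 [h1 h2] ss l c; rewrite h1 ?h2 //; exact: ss. Qed.

Lemma reach_same xs ys s s' : 14 \notin xs -> 2 \notin ys ->
  same xs ys s s' -> forall l c x, reach s l c x -> reach s' l c x.
Proof. by move=> x14 y2 [h1 h2] l c x; rewrite /reach h1 ?h2. Qed.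

Lemma cell_inj l c l' c' : c < M -> c' < M -> l * M + c = l' * M + c' ->
  l = l' /\ c = c'.
Proof.
move=> cM cM' e; have : (l * M + c) %/ M = (l' * M + c') %/ M by rewrite e.
rewrite !divnMDl // !divn_small // !addn0 => el; split=> //.
by move: e; rewrite el => /addnI.
Qed.

Lemma nval_rset s x i a e : nval (rset s x i a) e = nval s e.
Proof. by elim: e => //= [x' e ->|o e1 -> e2 ->]. Qed.

(** An overwritten weight never increases, so every instance of [reach] survives; distinct codes
    below [M] and distinct layers have distinct positions, so no other cell is disturbed. *)
Lemma wp_update s i c m r S t mask wgt :
  sound s -> c < M -> witness S i.+1 c m r -> i < n ->
  nval s t = i.+1 * M + c -> nval s mask = m -> rval s wgt = r.1 -> rlen s wgt = r.2 ->
  (nmem s 14 (i.+1 * M + c) != 0 -> (r.1 <= (rmem s 2 (i.+1 * M + c)).1)%R) ->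
  wp q b (RSet 2 t wgt ;; NSet 14 t mask)
    (fun s' => [/\ sound s', forall l c' x, reach s l c' x -> reach s' l c' x,
       reach s' i.+1 c r.1 & same [:: 14] [:: 2] s s']) s.
Proof.
move=> ss cM wit iN et em er el le; have [m_eq _ _ rlen_le] := wit.
apply: wp_then; apply: wp_rset => //.
  by move=> _; rewrite el; move: Mb b_large; lia.
apply: wp_nset => //; rewrite !nval_rset et em er el.
  by move=> _; rewrite m_eq; exact: mask_of_bitlen.
have m0 : m != 0 by rewrite m_eq -lt0n mask_of_gt0.
split.
- move=> l c' ln cM'; rewrite /=.
  have [e|ne] := eqVneq (l * M + c') (i.+1 * M + c).
    by have [-> ->] := cell_inj cM' cM e; rewrite !write_eq; exists S; case: (r) wit.
  by rewrite !write_neq_pos //; exact: ss.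
- move=> l c' x; rewrite /reach /=.
  have [->|ne] := eqVneq (l * M + c') (i.+1 * M + c).
    by move=> [/le h1 h2]; rewrite !write_eq; split=> //; exact: le_trans h1 h2.
  by rewrite !write_neq_pos.
- by rewrite /reach /= !write_eq.
- by apply: same_nset => //; apply: same_rset.
Qed.

Lemma wp_relax s i c m r S ce mask wgt :
  env s -> nmem s 4 0 = i ->
  sound s -> c < M -> witness S i.+1 c m r -> i < n ->
  nval s ce = c -> nval s mask = m -> rval s wgt = r.1 -> rlen s wgt = r.2 ->
  wp q b (relax_prog ce mask wgt)
    (fun s' => [/\ sound s', forall l c' x, reach s l c' x -> reach s' l c' x,
       reach s' i.+1 c r.1 & same [:: 14] [:: 2] s s']) s.
Proof.
move=> [_ _ eM _ _] ei ss cM wit iN ec em er el.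
have et : nval s (cell (nadd (reg 4) (NCst 1)) ce) = i.+1 * M + c.
  by rewrite /= ei eM ec addn1.
apply: wp_if => //; rewrite test_val_nle nval_get et /= lt0n => h.
  apply: wp_if => //; rewrite test_val_rle rval_get et er => h'.
    by apply: wp_skip; split => //; split.
  apply: (wp_update ss cM wit iN) => //.
  by move=> _; rewrite ltW // ltNge.
apply: (wp_update ss cM wit iN) => //.
by rewrite (negbTE h).
Qed.

(** Exchange argument: the next code depends on the current code and the decision only. If the cell
    of [code_of S i] holds a set no heavier than [S], extending it by the decision of [S] leads to
    the code of [S] in the next layer, again with no larger weight. *)
Lemma wp_table s : env s -> sound s -> (forall S, reach s 0 (code_of S 0) 0) ->
  wp q b (table_prog A L)
    (fun s' => [/\ env s', sound s' &
       forall S, reach s' n (code_of S n) (weight_of S n)]) s.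
Proof.
move=> env_s sound_s reach_s.
have same4 k s1 : same [:: 4] [::] s1 (nset s1 4 0 k) by exact: same_nset.
have same5 k s1 : same [:: 5] [::] s1 (nset s1 5 0 k) by exact: same_nset.
apply: (@wp_for _ _ _ _ _ _ _ n (fun i s' => [/\ env s', sound s' &
       forall S, reach s' i (code_of S i) (weight_of S i)])) => //.
- by move: b_large; lia.
- by move=> k s1 _ [[]].
- split.
  + exact: env_same (same4 _ _) _.
  + exact: sound_same (same4 _ _) _.
  + move=> S; apply: reach_same (same4 _ _) _ _ _ _ => //.
    by rewrite /weight_of big_ord0.
move=> i s1 iN ei [env1 sound1 reach1].
(* Layer [i] stays complete during its sweep, because later codes still read it; layer [i + 1] is
   complete for the codes already passed. *)
apply: (@wp_for _ _ _ _ _ _ _ M (fun c s' => [/\ env s', nmem s' 4 0 = i, sound s',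
    forall S, reach s' i (code_of S i) (weight_of S i) &
    forall S, code_of S i < c -> reach s' i.+1 (code_of S i.+1) (weight_of S i.+1)])) => //.
- by move=> k s2 _ [[]].
- move=> c s2 cM ec [env2 ei2 sound2 reach2 reachS2].
  have et : nval s2 (cell (reg 4) (reg 5)) = i * M + c.
    by case: env2 => _ _ eM _ _; rewrite /= ei2 eM ec.
  apply: wp_if => //; rewrite test_val_nle nval_get et /= lt0n => h; last first.
    apply: wp_skip; split=> //; split=> //; move=> S; rewrite ltnS leq_eqVlt => /predU1P[eS|/reachS2]; last first.
        exact: reach_same (same5 _ _) _ _ _.
      by have [] := reach2 S; rewrite eS (negbTE h).
  have [S wit] := sound2 i c (ltnW iN) cM h.
  apply: wp_then; apply: wp_weaken (wp_relax env2 ei2 sound2 cM (witness_skip wit) iN _ _ _ _) _.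
  + by [].
  + by rewrite ?nval_op nval_get et.
  + by rewrite rval_get et.
  + by rewrite rlen_get et.
  move=> s3 [sound3 mono23 reach3 same23].
  have env3 : env s3 by exact: env_same same23 _.
  have ei3 : nmem s3 4 0 = i by rewrite same23.1.
  have ec3 : nmem s3 5 0 = c by rewrite same23.1.
  apply: wp_then; apply: wp_weaken (wp_step env3 ei3 ec3) _.
  move=> s4 [ec' same34].
  have env4 : env s4 by exact: env_same same34 _.
  have sound4 : sound s4 by exact: sound_same same34 _.
  have mono34 : forall l c x, reach s3 l c x -> reach s4 l c x.
    by exact: reach_same same34.
  have ei4 : nmem s4 4 0 = i by rewrite same34.1.
  have ec4 : nmem s4 5 0 = c by rewrite same34.1.
  (* After the first relaxation the source cell is known only by monotonicity, so a set witnessing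
     it, possibly another one, is drawn from soundness again. *)
  have h4 : reach s4 i c (rmem s2 2 (i * M + c)).1 by apply: mono34; apply: mono23.
  have [S4 wit4] := sound4 i c (ltnW iN) cM h4.1.
  have et4 : nval s4 (cell (reg 4) (reg 5)) = i * M + c.
    by case: env4 => _ _ eM _ _; rewrite /= ei4 eM ec4.
  have [_ _ _ ew4 _] := env4.
  apply: wp_weaken (wp_relax env4 ei4 sound4 (next_code_lt i c) (witness_take wit4) iN _ _ _ _) _.
  + by [].
  + by rewrite ?nval_op nval_get et4.
  + by rewrite rval_op !rval_get et4 /= ei4 ew4.
  + by rewrite rlen_op !rlen_get et4 /= ei4 ew4.
  move=> s5 [sound5 mono45 reach5 same45].
  have env5 : env s5 by exact: env_same same45 _.
  have mono25 l c' x : reach s2 l c' x -> reach s5 l c' x.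
    by move=> ?; apply: mono45; apply: mono34; apply: mono23.
  split; first by rewrite same45.1.
  split.
  + exact: env_same (same5 _ _) _.
  + by rewrite /= /write /= same45.1.
  + exact: sound_same (same5 _ _) _.
  + by move=> S'; apply: reach_same (same5 _ _) _ _ _ _ => //; apply: mono25.
  + move=> S'; rewrite ltnS leq_eqVlt => /predU1P[eS|/reachS2]; last first.
      by move=> ?; apply: reach_same (same5 _ _) _ _ _ _ => //; apply: mono25.
    apply: reach_same (same5 _ _) _ _ _ _ => //.
    have := reach2 S'; rewrite eS => -[_ le2].
    rewrite weight_ofS; case: ifP => _.
      split; first by case: reach5.
      apply: le_trans reach5.2 _; rewrite /= lerD2r.
      exact: le_trans h4.2 le2.
    rewrite addr0.
    have [m5 le5] : reach s5 i.+1 c (rmem s2 2 (i * M + c)).1.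
      by apply: mono45; apply: mono34.
    by split=> //; exact: le_trans le5 le2.
- move=> s2 [env2 ei2 sound2 _ reach2]; split=> //.
  split.
  + exact: env_same (same4 _ _) _.
  + exact: sound_same (same4 _ _) _.
  + move=> S; apply: reach_same (same4 _ _) _ _ _ _ => //.
    by apply: reach2; exact: code_of_lt.
Qed.

Lemma wp_init s : nmem s = (fun x j => if (x == 0) && (j == 0) then n else 0) ->
  (forall j, rmem s 0 j = (wt j, 1)) -> rmem s 1 0 = (T, 1) ->
  (forall j, rmem s 2 j = (0%R, 1)) ->
  wp q b (init_prog L K)
    (fun s' => [/\ env s', sound s' & forall S, reach s' 0 (code_of S 0) 0]) s.
Proof.
move=> en ew eT e2.
apply: wp_then; apply: wp_nset => //=; rewrite en /= !addn1.
  by move=> _; apply: bl; rewrite -/B; move: b_large; lia.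
rewrite -/B; set s1 := nset _ _ _ _.
have eB : nmem s1 2 0 = B by rewrite /= write_eq.
apply: wp_then; apply: wp_nset => //; rewrite (nval_pow L.+1 eB) -/M.
  by move=> _; exact: bl.
apply: wp_nset => //=; rewrite write_eq subn1.
have cell0 t : write (write (write (nmem s) 2 0 B) 3 0 M) 14 M.-1 1 14 t
    = (t == M.-1) :> nat.
  have [->|ne] := eqVneq t M.-1; first by rewrite write_eq.
  by rewrite write_neq_pos // !write_neq // en.
split.
- by split=> //=; rewrite /write /= ?en.
- move=> l c ln cM; rewrite /= cell0; have [e _|//] := eqVneq (l * M + c) M.-1.
  have h : M.-1 < M by rewrite prednK.
  have [e1 e3] := @cell_inj l c 0 M.-1 cM h e.
  exists xpred0; subst l c; rewrite mul0n add0n e2; split => //=.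
  by rewrite /weight_of big_ord0.
- by move=> S; rewrite /reach /= mul0n add0n cell0 eqxx e2.
Qed.

Lemma wp_select s : env s -> reach s n M.-1 1 ->
  wp q b (select_prog L)
    (fun s' => [/\ same [:: 5; 12] [::] s s', nmem s' 12 0 < M,
       reach s n (nmem s' 12 0) 1 &
       forall c, c < M -> reach s n c 1 -> (score c <= score (nmem s' 12 0))%R]) s.
Proof.
move=> env_s reach_s; have [_ _ eM _ _] := env_s.
apply: wp_then; apply: wp_nset => //=; rewrite eM subn1.
  by move=> _; apply: bl; move: Mb; lia.
apply: (@wp_for _ _ _ _ _ _ _ M (fun k s' => [/\ same [:: 5; 12] [::] s s',
    nmem s' 12 0 < M, reach s n (nmem s' 12 0) 1 &
    forall c, c < k -> reach s n c 1 -> (score c <= score (nmem s' 12 0))%R])) => //.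
- by move=> k s1 _ [sm _ _ _]; rewrite /= sm.1.
- rewrite /= /write /=; split=> //; first by do 2 apply: same_nset => //.
  by rewrite prednK.
- move=> k s1 kM ek [sm bM reach_b best_b].
  have [e0 e2 eM1 _ _] : env s1 by apply: env_same sm env_s.
  have et : nval s1 (cell (reg 0) (reg 5)) = n * M + k by rewrite /= e0 eM1 ek.
  have e14 : nmem s1 14 = nmem s 14 by rewrite sm.1.
  have er2 : rmem s1 2 = rmem s 2 by rewrite sm.2.
  have skip : (reach s n k 1 -> (score k <= score (nmem s1 12 0))%R) ->
    wp q b Skip (fun s' => nmem s' 5 0 = k /\ [/\ same [:: 5; 12] [::] s (nset s' 5 0 k.+1),
    nmem (nset s' 5 0 k.+1) 12 0 < M, reach s n (nmem (nset s' 5 0 k.+1) 12 0) 1 &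
    forall c, c < k.+1 -> reach s n c 1 -> (score c <= score (nmem (nset s' 5 0 k.+1) 12 0))%R]) s1.
    move=> le; apply: wp_skip; rewrite /= /write /=.
    split=> //; split=> //; first exact: same_nset.
    by move=> c; rewrite ltnS leq_eqVlt => /predU1P[->|] //; exact: best_b.
  apply: wp_if => //; rewrite test_val_nle nval_get et /= lt0n e14 => h; last first.
    by apply: skip => -[]; rewrite (negbTE h).
  apply: wp_if => //; rewrite test_val_rle rval_get et er2 /= => h1; last first.
    by apply: skip => -[_]; rewrite (negbTE h1).
  apply: wp_if => //; rewrite test_val_rle !(rval_score L.+1 e2 erefl) /= -!/(score _) ek => h2; last first.
    by apply: skip => _; rewrite ltW // ltNge.
  apply: wp_nset => //=; rewrite ek /write /=; first by move=> _; apply: bl; move: Mb; lia.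
  split=> //; split=> //; first by do 2 apply: same_nset => //.
  move=> c; rewrite ltnS leq_eqVlt => /predU1P[->|ck rc] //.
  exact: le_trans (best_b _ ck rc) h2.
Qed.

Lemma wp_decode s S best : env s -> nmem s 12 0 = best ->
  nmem s 14 (n * M + best) = mask_of S n ->
  wp q b decode_prog (fun s' => forall t, t < n -> nmem s' 1 t = S t) s.
Proof.
move=> [e0 e2 eM _ _] eb em.
apply: wp_then; apply: wp_nset => //=; rewrite e0 eM eb em.
  by move=> _; exact: mask_of_bitlen.
apply: (@wp_for _ _ _ _ _ _ _ n (fun k s' => [/\ nmem s' 0 0 = n,
    nmem s' 13 0 = mask_of S (n - k) &
    forall t, n - k <= t < n -> nmem s' 1 t = S t])) => //.
- by move: b_large; lia.
- by move=> k s1 _ [].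
- rewrite /= /write /= subn0; split=> // t; lia.
- move=> k s1 kn ek [en e13 e1].
  have nk : n - k = (n - k.+1).+1 by lia.
  apply: wp_then; apply: wp_nset => //=; rewrite ?en ?ek e13 nk mask_of_half ?addn1 /= addKn.
    by move=> _; apply: bl; case: (S _).
  apply: wp_nset => //=; rewrite /write /= e13 nk mask_of_half.
    by move=> _; apply: mask_of_bitlen; lia.
  split=> //; split=> // t; case: eqP => [->|ne] // tn.
  by apply: e1; lia.
- by move=> s1 [_ _ h] t tn; apply: h; lia.
Qed.

(** Every feasible set makes its code a candidate of the selection, and the score depends on the
    code only; the set decoded from the best cell thus beats all of them while weighing at most
    1. *)
Lemma wp_knapsack s :
  nmem s = (fun x j => if (x == 0) && (j == 0) then n else 0) ->
  (forall j, rmem s 0 j = (wt j, 1)) -> rmem s 1 0 = (T, 1) ->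
  (forall j, rmem s 2 j = (0%R, 1)) ->
  wp q b (knapsack_prog A L K) (fun s' => exists S : nat -> bool,
    [/\ forall t, t < n -> nmem s' 1 t = S t, (weight_of S n <= 1)%R &
     forall S', (weight_of S' n <= 1)%R ->
       (score (code_of S' n) <= score (code_of S n))%R]) s.
Proof.
move=> en ew eT e2; apply: wp_then; apply: wp_weaken (wp_init en ew eT e2) _.
move=> s1 [env1 sound1 reach1].
apply: wp_then; apply: wp_weaken (wp_table env1 sound1 reach1) _.
move=> s2 [env2 sound2 reach2].
have reach_le S x : (weight_of S n <= x)%R -> reach s2 n (code_of S n) x.
  by move=> le; have [h1 h2] := reach2 S; split=> //; exact: le_trans h2 le.
have code0 : code_of xpred0 n = M.-1 by elim: (n).
have weight0 : weight_of xpred0 n = 0%R by rewrite /weight_of big1.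
have start : reach s2 n M.-1 1 by rewrite -code0; apply: reach_le; rewrite weight0.
apply: wp_then; apply: wp_weaken (wp_select env2 start) _.
move=> s3 [same23 bM reach_b best_b].
have [S [em ec eW _]] := sound2 _ _ (leqnn n) bM reach_b.1.
apply: wp_weaken (@wp_decode s3 S _ _ erefl _) _.
- exact: env_same same23 env2.
- by rewrite same23.1.
move=> s4 out; exists S; split=> //.
  by rewrite -eW; exact: reach_b.2.
move=> S' le; rewrite ec; apply: best_b; first exact: code_of_lt.
exact: reach_le.
Qed.

End Semantics.

Local Open Scope classical_set_scope.
Local Open Scope ring_scope.

(** * Bounded random variables *)

Section BoundedRandomVariables.
Context {R : realType} {d : measure_display} {Omega : measurableType d}
  (P : probability Omega R).
Implicit Types X Y G : Omega -> R.

(** Unlike integrability, boundedness is stable under products; it settles the integrability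
    conditions below. *)
Definition bounded_rv X :=
  measurable_fun setT X /\ exists C, forall x, `|X x| <= C.

Definition mean X : R := \int[P]_x X x.

Lemma bounded_rv_integrable X : bounded_rv X -> P.-integrable setT (EFin \o X).
Proof.
move=> [mX [C XC]]; apply: measurable_bounded_integrable => //.
  by rewrite [X in (X < _)%E]probability_setT ltry.
exists C; split; first exact: num_real.
by move=> M CM x _; apply: le_trans (XC x) (ltW CM).
Qed.

Lemma bounded_rv_cst r : bounded_rv (cst r).
Proof. by split; [exact: measurable_cst|exists `|r|]. Qed.

Lemma bounded_rvD X Y : bounded_rv X -> bounded_rv Y ->
  bounded_rv (fun x => X x + Y x).
Proof.
move=> [mX [C XC]] [mY [D YD]]; split; first exact: measurable_funD.
by exists (C + D) => x; apply: le_trans (ler_normD _ _) (lerD _ _).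
Qed.

Lemma bounded_rvM X Y : bounded_rv X -> bounded_rv Y ->
  bounded_rv (fun x => X x * Y x).
Proof.
move=> [mX [C XC]] [mY [D YD]]; split; first exact: measurable_funM.
by exists (C * D) => x; rewrite normrM ler_pM.
Qed.

Lemma bounded_rvZ r X : bounded_rv X -> bounded_rv (fun x => r * X x).
Proof. exact: bounded_rvM (bounded_rv_cst r). Qed.

Lemma bounded_rvB X Y : bounded_rv X -> bounded_rv Y ->
  bounded_rv (fun x => X x - Y x).
Proof.
move=> bX bY; rewrite [X in bounded_rv X](_ : _ = fun x => X x + (-1) * Y x).
  exact: bounded_rvD bX (bounded_rvZ _ bY).
by apply/funext => x; rewrite mulN1r.
Qed.

Lemma bounded_rv_sum I (s : seq I) (X : I -> Omega -> R) :
  (forall i, bounded_rv (X i)) -> bounded_rv (fun x => \sum_(i <- s) X i x).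
Proof.
move=> bX; elim: s => [|i s IH].
  under eq_fun do rewrite big_nil; exact: bounded_rv_cst.
by under eq_fun do rewrite big_cons; exact: bounded_rvD.
Qed.

Lemma bounded_rv_prod I (s : seq I) (X : I -> Omega -> R) :
  (forall i, bounded_rv (X i)) -> bounded_rv (fun x => \prod_(i <- s) X i x).
Proof.
move=> bX; elim: s => [|i s IH].
  under eq_fun do rewrite big_nil; exact: bounded_rv_cst.
by under eq_fun do rewrite big_cons; exact: bounded_rvM.
Qed.

Lemma bounded_rv_indic (A : set Omega) : measurable A -> bounded_rv \1_A.
Proof.
move=> mA; split; first exact: measurable_indic.
by exists 1 => x; rewrite indicE; case: (_ \in _); rewrite ?normr1 ?normr0.
Qed.

Lemma bounded_rv_itv X a b : measurable_fun setT X ->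
  (forall x, a <= X x <= b) -> bounded_rv X.
Proof.
move=> mX aXb; split=> //; exists (`|a| + `|b|) => x; have /andP[h1 h2] := aXb x.
rewrite ler_norml; have := ler_norm b; have := ler_norm (- a); rewrite normrN.
have := normr_ge0 a; have := normr_ge0 b; lra.
Qed.

Lemma mean_cst r : mean (cst r) = r.
Proof.
by rewrite /mean Rintegral_cst // [X in fine X]probability_setT mulr1.
Qed.

Lemma meanD X Y : bounded_rv X -> bounded_rv Y ->
  mean (fun x => X x + Y x) = mean X + mean Y.
Proof. by move=> bX bY; apply: RintegralD => //; exact: bounded_rv_integrable. Qed.

Lemma meanB X Y : bounded_rv X -> bounded_rv Y ->
  mean (fun x => X x - Y x) = mean X - mean Y.
Proof. by move=> bX bY; apply: RintegralB => //; exact: bounded_rv_integrable. Qed.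

Lemma meanZ r X : bounded_rv X -> mean (fun x => r * X x) = r * mean X.
Proof. by move=> bX; apply: RintegralZl => //; exact: bounded_rv_integrable. Qed.

Lemma mean_sum I (s : seq I) (X : I -> Omega -> R) :
  (forall i, bounded_rv (X i)) ->
  mean (fun x => \sum_(i <- s) X i x) = \sum_(i <- s) mean (X i).
Proof.
move=> bX; elim: s => [|i s IH].
  under eq_fun do rewrite big_nil; rewrite big_nil; exact: mean_cst.
under eq_fun do rewrite big_cons.
by rewrite meanD ?IH ?big_cons //; exact: bounded_rv_sum.
Qed.

Lemma mean_le X Y : bounded_rv X -> bounded_rv Y -> (forall x, X x <= Y x) ->
  mean X <= mean Y.
Proof.
by move=> bX bY XY; apply: le_Rintegral => //; exact: bounded_rv_integrable.
Qed.

Lemma mean_itv X a b : bounded_rv X -> (forall x, a <= X x <= b) ->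
  a <= mean X <= b.
Proof.
move=> bX aXb; rewrite -{1}(mean_cst a) -(mean_cst b).
by apply/andP; split; apply: mean_le => //; try exact: bounded_rv_cst;
  move=> x; have /andP[] := aXb x.
Qed.

Lemma mean_dist X Y e : bounded_rv X -> bounded_rv Y ->
  (forall x, `|X x - Y x| <= e) -> `|mean X - mean Y| <= e.
Proof.
move=> bX bY XY; rewrite -meanB // ler_norml; apply: mean_itv.
  exact: bounded_rvB.
by move=> x; rewrite -ler_norml.
Qed.

Lemma mean_indic (A : set Omega) : measurable A -> (mean \1_A)%:E = P A.
Proof.
move=> mA; rewrite /mean /Rintegral integral_indic // setIT fineK //.
exact: fin_num_measure.
Qed.

Lemma mean_expectation X : bounded_rv X -> ('E_P[X] = (mean X)%:E)%E.
Proof.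
move=> /bounded_rv_integrable iX; rewrite unlock /mean /Rintegral fineK //.
exact: integrable_fin_num.
Qed.

Definition level X (h : R) : set Omega := X @^-1` `[h, +oo[.

Lemma measurable_level X h : measurable_fun setT X -> measurable (level X h).
Proof. by move=> mX; rewrite -[level X h]setTI; apply: mX. Qed.

Lemma indic_level X h x : \1_(level X h) x = (h <= X x)%R%:R :> R.
Proof.
rewrite indicE; congr (nat_of_bool _)%:R; apply/idP/idP.
  by move/set_mem; rewrite /level /= in_itv /= andbT.
by move=> h1; apply/mem_set; rewrite /level /= in_itv /= andbT.
Qed.

(* Layer cake at the thresholds [h / N]. *)
Definition staircase (N : nat) X (x : Omega) : R :=
  N%:R^-1 * \sum_(h < N) \1_(level X (h.+1%:R / N%:R)) x.

(** The number of thresholds not above [X x] is the integer part of [N * X x], so the staircase is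
    [X x] rounded down to a multiple of [1 / N]. *)
Lemma staircase_dist N X x : (0 < N)%N -> 0 <= X x <= 1 ->
  `|X x - staircase N X x| <= N%:R^-1.
Proof.
move=> N0 /andP[X0 X1]; have N0' : 0 < N%:R :> R by rewrite ltr0n.
have -> : staircase N X x = N%:R^-1 * (Num.trunc (N%:R * X x))%:R.
  congr (_ * _).
  set k := Num.trunc _; have kN : (k <= N)%N.
    rewrite -(ler_nat R); apply: le_trans (_ : N%:R * X x <= _).
      by rewrite /k truncn_le mulr_ge0 // ltW.
    by rewrite ler_piMr // ltW.
  transitivity (\sum_(h < N) (h < k)%N%:R : R).
    apply: eq_bigr => h _; rewrite indic_level ler_pdivrMr // mulrC.
    by rewrite -truncn_gt_nat.
  rewrite -(subnKC kN) big_split_ord /= [X in _ + X]big1 ?addr0; last first.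
    by move=> i _; rewrite ltnNge leq_addr.
  rewrite (eq_bigr (fun=> 1)); first by rewrite sumr_const card_ord.
  by move=> i _; rewrite ltn_ord.
have /truncn_itv : 0 <= N%:R * X x by rewrite mulr_ge0 // ltW.
move=> /andP[h1 h2]; rewrite -[X in `|X - _|](mulKf (lt0r_neq0 N0')) -mulrBr.
rewrite normrM gtr0_norm ?invr_gt0 // -[leRHS]mulr1 ler_pM2l ?invr_gt0 //.
rewrite ler_norml -natr1 in h2 *; lra.
Qed.

Lemma bounded_staircase N X : measurable_fun setT X -> bounded_rv (staircase N X).
Proof.
move=> mX; apply: bounded_rvZ; apply: bounded_rv_sum => h.
by apply: bounded_rv_indic; exact: measurable_level.
Qed.

(** Both sides are linear in [X] and stable under uniform approximation. They agree on staircases,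
    which leaves an error of at most [(1 + |c|) / N] for every [N]. *)
Lemma mean_mul_level X G c : measurable_fun setT X -> (forall x, 0 <= X x <= 1) ->
  measurable_fun setT G -> (forall x, 0 <= G x <= 1) ->
  (forall h, mean (fun x => \1_(level X h) x * G x) = mean \1_(level X h) * c) ->
  mean (fun x => X x * G x) = mean X * c.
Proof.
move=> mX X01 mG G01 levelE.
have bX := bounded_rv_itv mX X01; have bG := bounded_rv_itv mG G01.
have b1 h : bounded_rv \1_(level X h).
  by apply: bounded_rv_indic; exact: measurable_level.
have stairE N : mean (fun x => staircase N X x * G x) = mean (staircase N X) * c.
  rewrite /staircase meanZ; last exact: bounded_rv_sum.
  under eq_fun do rewrite -mulrA mulr_suml.
  rewrite meanZ; last by apply: bounded_rv_sum => h; exact: bounded_rvM.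
  rewrite -mulrA !mean_sum //; last by move=> h; exact: bounded_rvM.
  by congr (_ * _); rewrite mulr_suml; apply: eq_bigr => h _; exact: levelE.
have close N : (0 < N)%N ->
    `|mean (fun x => X x * G x) - mean X * c| <= (1 + `|c|) / N%:R.
  move=> N0; have bS := bounded_staircase N mX.
  have h1 : `|mean (fun x => X x * G x) - mean (fun x => staircase N X x * G x)|
      <= N%:R^-1.
    apply: mean_dist; [exact: bounded_rvM..|] => x.
    rewrite -mulrBl normrM -[leRHS]mulr1; have /andP[G0 G1] := G01 x.
    by rewrite ler_pM // ?staircase_dist // ger0_norm.
  have h2 : `|mean X - mean (staircase N X)| <= N%:R^-1.
    by apply: mean_dist => // x; exact: staircase_dist.
  rewrite -(subrK (mean (staircase N X) * c) (mean _)) -stairE -addrA.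
  apply: le_trans (ler_normD _ _) _; rewrite mulrDl mul1r lerD //.
  by rewrite stairE -mulrBl normrM distrC mulrC ler_wpM2l.
apply/eqP; rewrite -subr_eq0 -normr_le0; apply/ler_addgt0Pr => e e0.
rewrite add0r; pose N := (Num.trunc ((1 + `|c|) / e)).+1.
apply: le_trans (close N isT) _; rewrite ler_pdivrMr ?ltr0n // mulrC.
rewrite -ler_pdivrMr //; have /truncn_itv/andP[_ /ltW //] : 0 <= (1 + `|c|) / e.
by rewrite divr_ge0 ?addr_ge0 // ltW.
Qed.

Lemma mean_prod_level (I : finType) (X : I -> Omega -> R) :
  (forall i, measurable_fun setT (X i)) -> (forall i x, 0 <= X i x <= 1) ->
  (forall (J : {set I}) (h : I -> R),
    P (\bigcap_(i in [set` J]) level (X i) (h i)) =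
    (\prod_(i in J) P (level (X i) (h i)))%E) ->
  forall J : {set I},
    mean (fun x => \prod_(i in J) X i x) = \prod_(i in J) mean (X i).
Proof.
move=> mX X01 indep.
have ml i h : measurable (level (X i) h) by exact: measurable_level.
pose ind i h x : R := \1_(level (X i) h) x.
have b_ind i h : bounded_rv (ind i h) by exact: bounded_rv_indic.
have ind01 i h x : 0 <= ind i h x <= 1.
  by rewrite /ind indicE; case: (_ \in _); rewrite ?lexx ?ler01.
have prod01 (s : seq I) (Y : I -> R) : (forall i, 0 <= Y i <= 1) ->
    0 <= \prod_(i <- s) Y i <= 1.
  move=> Y01; elim/big_ind: _ => [|x y /andP[? ?] /andP[? ?]|i _] //.
    by rewrite ler01 lexx.
  by rewrite mulr_ge0 //= mulr_ile1.
(* The indicators are replaced by the variables one at a time: [s] lists the variables already in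
   place, [J] the indices still represented by an indicator of a level. *)
suff main (s : seq I) (J : {set I}) h : uniq s -> (forall i, i \in s -> i \notin J) ->
    mean (fun x => \prod_(i <- s) X i x * \prod_(i <- enum J) ind i (h i) x) =
    \prod_(i <- s) mean (X i) * \prod_(i <- enum J) mean (ind i (h i)).
  move=> J; have := main (enum J) finset.set0 (fun=> 0) (enum_uniq _).
  under eq_fun do rewrite enum_set0 [X in _ * X]big_nil mulr1 big_enum.
  rewrite enum_set0 [X in _ = _ * X]big_nil mulr1 big_enum; apply.
  by move=> i _; rewrite inE.
elim: s J h => [|k s IH] J h.
  move=> _ _; rewrite big_nil mul1r; under eq_fun do rewrite big_nil mul1r.
  rewrite [X in mean X](_ : _ = \1_(\bigcap_(i in [set` J]) level (X i) (h i))).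
    apply: EFin_inj; rewrite mean_indic; last first.
      by apply: fin_bigcap_measurable => // i _; exact: ml.
    rewrite indep big_enum /= -prodEFin; apply: eq_bigr => i _.
    by rewrite mean_indic.
  apply/funext => x; rewrite big_enum /= indicE.
  case: (boolP (x \in _)) => [/set_mem h1|h1].
    rewrite big1 // => i iJ; rewrite /ind indicE mem_set //.
    exact: h1.
  apply/eqP/prodf_eq0; apply: contrapT => h2; move/negP: h1; apply.
  apply/mem_set => i iJ; apply: contrapT => h3; apply: h2; exists i => //.
  by rewrite /ind indicE memNset.
move=> /= /andP[ks us] sJ.
have kJ : k \notin J by apply: sJ; rewrite inE eqxx.
have mean_k : mean (fun x => X k x * (\prod_(i <- s) X i x * \prod_(i <- enum J) ind i (h i) x)) =
    mean (X k) * (\prod_(i <- s) mean (X i) * \prod_(i <- enum J) mean (ind i (h i))).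
  apply: mean_mul_level => //.
  - apply: measurable_funM; first exact: measurable_prod.
    by apply: measurable_prod => i _; exact: (b_ind _ _).1.
  - move=> x; have /andP[? ?] := prod01 s (X^~ x) (X01^~ x).
    have /andP[? ?] := prod01 (enum J) (fun i => ind i (h i) x) (fun i => ind01 _ _ _).
    by rewrite mulr_ge0 //= mulr_ile1.
  (* The indicator of a level of [X k] joins those of [J], with threshold [t] at [k]: this is the
     induction hypothesis for [k |: J]. *)
  - move=> t; pose h' i := if i == k then t else h i.
    have J'E (Y : I -> R -> R) : \prod_(i <- enum (k |: J)) Y i (h' i) =
        Y k t * \prod_(i <- enum J) Y i (h i).
      rewrite !big_enum /= big_setU1 //= /h' eqxx; congr (_ * _).
      by apply: eq_bigr => i iJ; case: eqP => // ik; rewrite -ik iJ in kJ.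
    have := IH (k |: J) h' us; rewrite (J'E (fun i t => mean (ind i t))).
    under eq_fun do rewrite (J'E (fun i t => ind i t _)) mulrCA.
    rewrite mulrCA; apply => i si; rewrite !inE negb_or.
    rewrite sJ ?inE ?si ?orbT // andbT.
    by apply: contraNneq ks => <-.
under eq_fun do rewrite big_cons -mulrA.
by rewrite mean_k big_cons mulrA.
Qed.

End BoundedRandomVariables.

(** * Rounding errors and the smooth utility *)

Lemma leq_expn m n e : (m <= n -> m ^ e <= n ^ e)%N.
Proof. by case: e => // e; rewrite leq_exp2r. Qed.

(** For positive [n], [n + 1 <= 2 * n] costs a factor [2 ^ e]; the additive term takes care of
    [n = 0]. *)
Lemma poly_bound (c e : nat) : exists k, forall n,
  (c * n.+1 ^ e <= k * n ^ k + k)%N.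
Proof.
exists (c * 2 ^ e + e)%N => -[|n].
  rewrite exp1n muln1; apply: leq_trans (leq_addl _ _).
  by apply: leq_trans (leq_addr _ _); rewrite leq_pmulr // expn_gt0.
apply: leq_trans (leq_addr _ _).
apply: (@leq_trans (c * (2 * n.+1) ^ e)%N).
  by rewrite leq_mul2l; apply/orP; right; apply: leq_expn; lia.
by rewrite expnMn mulnA leq_mul ?leq_addr // leq_pexp2l // leq_addl.
Qed.

(** With [A], [L] and [K] fixed, the length bound is dominated by [B ^ L.+1], of order
    [n ^ L.+1]. *)
Lemma csz_knapsack_poly (A L K : nat) : exists k, forall n,
  let B := (K * n.+1).+1 in
  (csz (2 * n + B ^ L.+1 + B + A * L + L + 20) (knapsack_prog A L K)
    <= k * n ^ k + k)%N.
Proof.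
have [C HC] := csz_poly (knapsack_prog A L K).
pose D := (2 + K.+1 ^ L.+1 + K.+1 + A * L + L + 21)%N.
have [k Hk] := poly_bound (C * D ^ C) (L.+1 * C).
exists k => n; cbv zeta; set B := (K * n.+1).+1.
apply: leq_trans (Hk n); apply: leq_trans (HC _) _.
rewrite -mulnA leq_mul2l; apply/orP; right; rewrite expnM -expnMn.
apply: leq_expn; set y := (n.+1 ^ L.+1)%N.
have hy : (n.+1 <= y)%N by rewrite -[X in (X <= _)%N]expn1 leq_pexp2l.
have hB : (B <= K.+1 * n.+1)%N by rewrite /B mulSn -addn1 addnC leq_add.
have hM : (B ^ L.+1 <= K.+1 ^ L.+1 * y)%N by rewrite -expnMn leq_exp2r.
have hB' : (B <= K.+1 * y)%N by apply: leq_trans hB _; rewrite leq_mul2l hy orbT.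
rewrite /D; nia.
Qed.

(** * Propagation of the rounding errors *)

Section Rounding.
Context {R : realType}.

(** One unit comes from the error on [y], one from rounding down; the cap and the floor at 0 do no
    harm since [z] lies in [[0, g]]. *)
Lemma grid_round_dist g (y z : R) : `|y - z| <= 1 -> 0 <= z <= g%:R ->
  `|(grid_round g y)%:R - z| <= 2.
Proof.
move=> yz /andP[z0 zg].
have lo : (grid_round g y = 0%N) \/ (grid_round g y)%:R <= y.
  by elim: g {zg} => [|g IH] /=; [left|case: ifP => [h|_] //; right].
have hi : (grid_round g y = g) \/ y < (grid_round g y).+1%:R.
  elim: g {zg lo} => [|g IH] /=; [by left|case: ifP => [h|/negbT h]; first by left].
  by case: IH => [->|IH]; right => //; rewrite ltNge.
move: yz lo hi; rewrite !ler_norml -natr1 => /andP[h1 h2] [->|h3] [h4|h4].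
- by move: zg; rewrite -h4; lra.
- lra.
- by rewrite h4 in h3 *; lra.
- lra.
Qed.

Variables (q : oracle R) (A L K n : nat) (T : R).
Let B := (K * n.+1).+1.

Hypothesis K_gt0 : (0 < K)%N.
Variable m : nat -> nat -> R.
Hypothesis m01 : forall t j, 0 <= m t j <= 1.
Hypothesis query_m : forall t j, (t < n)%N -> (j <= L)%N ->
  `|transform_query q A K n T t j - m t j| <= B%:R^-1.

Definition product_of (S : nat -> bool) (l j : nat) : R :=
  \prod_(t < l) if S t then m t j else 1.

(** A factor in [[0, 1]] does not amplify the error inherited from earlier items. The query error
    [1 / B] times a digit below [B] is at most 1, so each item adds at most 2. *)
Lemma digit_code_dist S l j : (l <= n)%N -> (j <= L)%N ->
  `|(digit B j (code_of q A L K n T S l))%:R - (K * n.+1)%:R * product_of S l j|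
    <= (2 * l)%:R.
Proof.
move=> ln jL; elim: l ln => [|l IH] ln /=.
  by rewrite /product_of big_ord0 digit_predn // mulr1 subrr normr0.
have {}IH := IH (ltnW ln).
rewrite /product_of big_ord_recr /= -/(product_of S l j).
case: ifP => _; last first.
  by rewrite mulr1; apply: le_trans IH _; rewrite ler_nat leq_mul2l leqnSn.
rewrite digit_sum //; last by move=> k; exact: rounded_lt.
set c := code_of _ _ _ _ _ _ _ _ in IH *; rewrite /rounded -/B.
set g := digit B j c in IH *; set mh := transform_query _ _ _ _ _ _ _.
have /andP[m0 m1] := m01 l j.
have gB : (g%:R : R) <= B%:R by rewrite ler_nat ltnW // digit_lt.
have B0 : 0 < B%:R :> R by rewrite ltr0n.
have h1 : `|(grid_round g (g%:R * mh))%:R - g%:R * m l j| <= 2.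
  apply: grid_round_dist; last by rewrite mulr_ge0 //= ler_piMr.
  rewrite -mulrBr normrM ger0_norm //; apply: le_trans (_ : B%:R * B%:R^-1 <= _).
    by rewrite ler_pM // query_m.
  by rewrite mulfV // gt_eqF.
have h2 : `|g%:R * m l j - (K * n.+1)%:R * product_of S l j * m l j| <= (2 * l)%:R.
  by rewrite -mulrBl normrM (ger0_norm m0); apply: le_trans IH; rewrite ler_piMr.
rewrite mulrA -(subrK (g%:R * m l j) (grid_round _ _)%:R) -addrA (mulnS 2 l) (natrD _ 2).
by apply: le_trans (ler_normD _ _) (lerD _ _).
Qed.

Definition value_of (S : nat -> bool) : R :=
  \sum_(j < L.+1) (-1) ^+ j * 'C(L, j)%:R * product_of S n j.

Lemma score_dist S :
  `|score L K n (code_of q A L K n T S n) - (K * n.+1)%:R * value_of S|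
    <= 2 ^+ L * (2 * n)%:R.
Proof.
rewrite /score /value_of mulr_sumr -sumrB.
have -> : (2 : R) ^+ L = \sum_(j < L.+1) 'C(L, j)%:R.
  rewrite -[2](@natr1 R 1) exprDn; apply: eq_bigr => i _.
  by rewrite !expr1n mulr1.
rewrite mulr_suml; apply: le_trans (ler_norm_sum _ _ _) (ler_sum _ _) => j _.
rewrite natrM mulrA mulrCA -mulrBr normrM normrM normrX normrN1 expr1n mul1r.
rewrite ger0_norm // ler_wpM2l //; apply: digit_code_dist => //.
by rewrite -ltnS.
Qed.

(** Each score is off by at most [2 ^ L * 2 * n] in units of [1 / N]; the two errors together stay
    below [theta * N] because [N = K * n.+1]. *)
Lemma score_le_value S S' (theta : R) : 2 ^+ L * 4 <= theta * K%:R ->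
  (score L K n (code_of q A L K n T S' n) <= score L K n (code_of q A L K n T S n) :> R) ->
  value_of S' <= value_of S + theta.
Proof.
move=> Kbig le; have := score_dist S; have := score_dist S'.
rewrite !ler_norml => /andP[h1 h2] /andP[h3 h4].
have N0 : 0 < (K * n.+1)%:R :> R by rewrite ltr0n muln_gt0 K_gt0.
rewrite -(ler_pM2l N0) mulrDr.
have h5 : 2 ^+ L * (4 * n)%:R <= (K * n.+1)%:R * theta.
  rewrite natrM mulrA; apply: le_trans (_ : theta * K%:R * n%:R <= _).
    by rewrite ler_wpM2r.
  rewrite [leRHS]mulrC natrM mulrA ler_wpM2l ?ler_nat //.
  by apply: le_trans Kbig; rewrite mulr_ge0 // exprn_ge0.
have : 2 ^+ L * (4 * n)%:R = 2 ^+ L * (2 * n)%:R + 2 ^+ L * (2 * n)%:R :> R.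
  by rewrite -mulrDr -natrD; congr (_ * _%:R); lia.
move=> h6; rewrite h6 in h5; lra.
Qed.

End Rounding.

(** * The smooth utility and its bounds on both sides of the threshold *)

Section Utility.
Context {R : realType}.

(* [L] is about [theta * e^A], so that [L * e^(- A y)] is small for [y >= 1]
   and large for [y <= 1 - e]. *)
Lemma utility_parameters (e theta : R) : 0 < e < 1 -> 0 < theta ->
  exists A L : nat, L%:R * expR (- A%:R) <= theta /\
    expR (- (L%:R * expR (- (A%:R * (1 - e))))) <= theta.
Proof.
move=> /andP[e0 e1] t0; pose A := (Num.trunc ((theta^-1 + 1) / (theta * e))).+1.
pose L := Num.trunc (theta * expR A%:R).
have [|L1 L2] := andP (@truncn_itv R (theta * expR A%:R) _).
  by rewrite mulr_ge0 ?expR_ge0 // ltW.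
have hA : (theta^-1 + 1) / (theta * e) <= A%:R.
  have /truncn_itv/andP[_ /ltW //] : 0 <= (theta^-1 + 1) / (theta * e).
  by rewrite divr_ge0 ?mulr_ge0 ?addr_ge0 ?invr_ge0 // ltW.
exists A, L; split.
  by rewrite expRN ler_pdivrMr ?expR_gt0.
(* Since [L > theta e^A - 1], the right side is at least [theta e^(A e) - 1], hence at least
   [theta (1 + A e) - 1]; [A] was chosen so that [theta A e >= theta^-1 + 1]. *)
have big : theta^-1 <= L%:R * expR (- (A%:R * (1 - e))).
  rewrite -/L -natr1 in L2.
  apply: le_trans (_ : (theta * expR A%:R - 1) * expR (- (A%:R * (1 - e))) <= _); last first.
    by rewrite ler_wpM2r ?expR_ge0 //; lra.
  rewrite mulrBl mul1r -mulrA -expRD.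
  rewrite (_ : A%:R + - (A%:R * (1 - e)) = A%:R * e); last by ring.
  have h1 : expR (- (A%:R * (1 - e))) <= 1.
    by rewrite -[leRHS]expR0 ler_expR oppr_le0 mulr_ge0 // subr_ge0 ltW.
  have h2 : theta * (1 + A%:R * e) <= theta * expR (A%:R * e).
    by rewrite ler_pM2l // expR_ge1Dx.
  move: hA; rewrite ler_pdivrMr ?mulr_gt0 // => hA.
  lra.
rewrite expRN -[leRHS]invrK lef_pV2 ?posrE ?expR_gt0 ?invr_gt0 //.
by apply: le_trans big (le_trans _ (expR_ge1Dx _)); rewrite lerDr.
Qed.

Lemma bernoulli_le (z : R) L : 0 <= z <= 1 -> 1 - L%:R * z <= (1 - z) ^+ L.
Proof.
move=> /andP[z0 z1]; elim: L => [|L IH]; first by rewrite mul0r subr0 expr0.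
rewrite exprS; apply: le_trans (_ : (1 - z) * (1 - L%:R * z) <= _).
  have : 0 <= L%:R * z * z by rewrite !mulr_ge0.
  by rewrite -natr1; lra.
by rewrite ler_wpM2l // subr_ge0.
Qed.

Lemma pow_le_exp (z : R) L : 0 <= z <= 1 -> (1 - z) ^+ L <= expR (- (L%:R * z)).
Proof.
move=> /andP[z0 z1]; rewrite -mulrN expRM_natl lerXn2r ?nnegrE ?subr_ge0 ?expR_ge0 //.
exact: expR_ge1Dx.
Qed.

Definition utility (A L : nat) (y : R) : R := (1 - expR (- (A%:R * y))) ^+ L.

Section Bounds.
Variables (e theta : R) (A L : nat).
Hypothesis L_small : L%:R * expR (- A%:R) <= theta.
Hypothesis L_big : expR (- (L%:R * expR (- (A%:R * (1 - e))))) <= theta.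
Variable y : R.
Hypothesis y_ge0 : 0 <= y.

Let z01 : 0 <= expR (- (A%:R * y)) <= 1.
Proof.
by rewrite expR_ge0 -[leRHS]expR0 ler_expR oppr_le0 mulr_ge0.
Qed.

Lemma utility_itv : 0 <= utility A L y <= 1.
Proof.
have /andP[z0 z1] := z01; rewrite exprn_ge0 ?subr_ge0 //=.
by rewrite exprn_ile1 ?subr_ge0 // gerBl.
Qed.

Lemma utility_ge : 1 <= y -> 1 - theta <= utility A L y.
Proof.
move=> y1; apply: le_trans (bernoulli_le L z01).
rewrite lerD2l lerN2; apply: le_trans L_small; rewrite ler_wpM2l // ler_expR lerN2.
by rewrite ler_peMr.
Qed.

Lemma utility_le : y <= 1 - e -> utility A L y <= theta.
Proof.
move=> ye; apply: le_trans (pow_le_exp L z01) (le_trans _ L_big).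
by rewrite ler_expR lerN2 ler_wpM2l // ler_expR lerN2 ler_wpM2l.
Qed.

End Bounds.
End Utility.

(** * The knapsack *)

Section Knapsack.
Context {R : realType} (n : nat) (w : 'I_n -> R) (T : R).
Context {d : measure_display} {Omega : measurableType d}
  (P : probability Omega R) (v : 'I_n -> {RV P >-> R}).
Hypothesis T_gt0 : 0 < T.
Hypothesis v_ge0 : forall i x, 0 <= v i x.
Hypothesis v_indep : mutually_independent v.
Variables (A L : nat).
Implicit Types S : {set 'I_n}.

Lemma measurable_profit S : measurable_fun setT (profit v S).
Proof.
rewrite (_ : profit v S = fun x => \sum_(i <- enum S) v i x).
  by apply: measurable_sum => i; exact: measurable_funPT.
by apply/funext => x; rewrite big_enum.
Qed.

Lemma profit_ge0 S x : 0 <= profit v S x.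
Proof. by apply: sumr_ge0 => i _; exact: v_ge0. Qed.

Definition rate (j : nat) : R := (0%:R - (A * j)%:R) / T.

Lemma rate_le0 j : rate j <= 0.
Proof. by rewrite /rate sub0r mulNr oppr_le0 divr_ge0 // ltW. Qed.

Definition discount (i : 'I_n) (j : nat) (x : Omega) : R := expR (rate j * v i x).

Definition transform (i : 'I_n) (j : nat) : R := mean P (discount i j).

Lemma discount_itv i j x : 0 <= discount i j x <= 1.
Proof.
by rewrite expR_ge0 -[leRHS]expR0 ler_expR mulr_le0_ge0 // rate_le0.
Qed.

Lemma measurable_discount i j : measurable_fun setT (discount i j).
Proof.
apply: measurableT_comp => //; apply: measurable_funM => //.
Qed.

Lemma bounded_discount i j : bounded_rv (discount i j).
Proof.
exact: bounded_rv_itv (@measurable_discount i j) (discount_itv i j).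
Qed.

Lemma transform_itv i j : 0 <= transform i j <= 1.
Proof. apply: mean_itv; [exact: bounded_discount|exact: discount_itv]. Qed.

Lemma mean_prod_discount S j :
  mean P (fun x => \prod_(i in S) discount i j x) = \prod_(i in S) transform i j.
Proof.
apply: mean_prod_level => [i|i x|J h].
- exact: measurable_discount.
- exact: discount_itv.
(* A level set of a discount is the preimage under [v i] of a measurable set of reals, to which the
   independence of the profits applies. *)
pose B i := (fun y : R => expR (rate j * y)) @^-1` `[h i, +oo[.
apply: (v_indep J (A := B)) => i; rewrite -[B i]setTI.
suff : measurable_fun setT (fun y : R => expR (rate j * y)) by apply.
by apply: measurableT_comp => //; exact: measurable_funM.
Qed.

Definition mean_utility (S : {set 'I_n}) : R :=
  mean P (fun x => utility A L (profit v S x / T)).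

Lemma mean_utilityE S : mean_utility S =
  \sum_(j < L.+1) (-1) ^+ j * 'C(L, j)%:R * \prod_(i in S) transform i j.
Proof.
have b_prod j : bounded_rv (fun x => \prod_(i in S) discount i j x).
  have := bounded_rv_prod (enum S) (fun i => bounded_discount i j).
  by under eq_fun do rewrite big_enum.
rewrite /mean_utility (_ : (fun x => _) = fun x =>
    \sum_(j < L.+1) (-1) ^+ j * 'C(L, j)%:R * \prod_(i in S) discount i j x).
  rewrite mean_sum; last by move=> j; exact: bounded_rvZ.
  by apply: eq_bigr => j _; rewrite meanZ // mean_prod_discount.
apply/funext => x; rewrite /utility exprBn; apply: eq_bigr => j _.
rewrite expr1n mulr1 -mulr_natr mulrAC; congr (_ * _).
rewrite -expRM_natl /discount -expR_sum; congr expR.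
rewrite -mulr_sumr -/(profit v S x) /rate natrM; ring.
Qed.

Lemma bounded_utility S : bounded_rv (fun x => utility A L (profit v S x / T)).
Proof.
apply: (@bounded_rv_itv _ _ _ _ 0 1).
  apply: measurable_funX; apply: measurable_funB => //.
  apply: measurableT_comp => //; apply: measurableT_comp => //.
  apply: measurable_funM => //; apply: measurable_funM => //.
  exact: measurable_profit.
by move=> x; apply: utility_itv; rewrite divr_ge0 ?profit_ge0 // ltW.
Qed.

Lemma mean_utility_ge (theta : R) S : 0 <= theta -> L%:R * expR (- A%:R) <= theta ->
  (((1 - theta)%:E * P [set x | (T <= profit v S x)%R]) <= (mean_utility S)%:E)%E.
Proof.
move=> t0 L_small; rewrite (_ : [set x | _] = level (profit v S) T); last first.
  by apply/seteqP; split=> x; rewrite /level /= in_itv /= andbT.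
have mE := measurable_level T (measurable_profit S).
rewrite -mean_indic // -EFinM lee_fin -meanZ; last exact: bounded_rv_indic.
apply: mean_le => [||x].
- by apply: bounded_rvZ; exact: bounded_rv_indic.
- exact: bounded_utility.
have y0 : 0 <= profit v S x / T by rewrite divr_ge0 ?profit_ge0 // ltW.
rewrite indic_level; case: (leP T (profit v S x)) => [h|_]; last first.
  by rewrite mulr0n mulr0; have /andP[] := utility_itv A L y0.
by rewrite mulr1n mulr1; apply: utility_ge => //; rewrite ler_pdivlMr // mul1r.
Qed.

Lemma measurable_profit_gt (a : R) S : measurable [set x | a < profit v S x].
Proof.
rewrite (_ : [set x | _] = profit v S @^-1` `]a, +oo[); last first.
  by apply/seteqP; split=> x; rewrite /= in_itv /= andbT.
by rewrite -[X in measurable X]setTI; apply: measurable_profit.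
Qed.

Lemma mean_utility_le (e theta : R) S : 0 <= theta ->
  expR (- (L%:R * expR (- (A%:R * (1 - e))))) <= theta ->
  ((mean_utility S)%:E <= P [set x | ((1 - e) * T < profit v S x)%R] + theta%:E)%E.
Proof.
move=> t0 L_big; set E := [set x | _].
have mE : measurable E by exact: measurable_profit_gt.
have b1 := bounded_rv_indic mE.
have bt : bounded_rv (cst theta : Omega -> R) := bounded_rv_cst theta.
rewrite -mean_indic // -EFinD lee_fin -[X in _ + X](mean_cst P theta) -meanD //.
apply: mean_le => [||x]; [exact: bounded_utility|exact: bounded_rvD|].
have y0 : 0 <= profit v S x / T by rewrite divr_ge0 ?profit_ge0 // ltW.
rewrite indicE; case: (boolP (x \in E)) => [_|/negP xE].
  have /andP[_ u1] := utility_itv A L y0; apply: le_trans u1 _.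
  by rewrite /= lerDl.
rewrite add0r /=; apply: (utility_le L_big y0); rewrite ler_pdivrMr // leNgt.
by apply/negP => h; apply: xE; exact: mem_set.
Qed.

(** The analysis of the program indexes items by natural numbers. With default 0, the extended
    weights are convertible to the values that [input] stores. *)
Definition extend_ord (V : Type) (f : 'I_n -> V) (a : V) (t : nat) : V :=
  if insub t is Some i then f i else a.

Lemma extend_ordE (V : Type) (f : 'I_n -> V) a (i : 'I_n) : extend_ord f a i = f i.
Proof. by rewrite /extend_ord valK. Qed.

Lemma weight_of_set (S : nat -> bool) :
  weight_of (extend_ord w 0) S n = weight w [set i : 'I_n | S i]%SET.
Proof.
rewrite /weight_of /weight [RHS]big_mkcond; apply: eq_bigr => i _.
by rewrite inE extend_ordE.
Qed.

Lemma value_of_set (S : nat -> bool) :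
  value_of L n (fun t j => extend_ord (transform^~ j) 1 t) S =
  mean_utility [set i : 'I_n | S i]%SET.
Proof.
rewrite /value_of mean_utilityE; apply: eq_bigr => j _; congr (_ * _).
rewrite /product_of [RHS]big_mkcond; apply: eq_bigr => i _.
by rewrite inE extend_ordE.
Qed.

Lemma query_transform (q : oracle R) K t j : computes_transforms v q -> (t < n)%N ->
  `|transform_query q A K n T t j - extend_ord (transform^~ j) 1 t|
    <= (K * n.+1).+1%:R^-1.
Proof.
move=> qv tn; rewrite -[t]/(val (Ordinal tn)) extend_ordE.
have [] := qv (Ordinal tn) (rate j) 0 (1%:R / (K * n.+1).+1%:R) (rate_le0 j).
  by rewrite divr_gt0 // ltr0n.
rewrite (_ : (fun x => _) = discount (Ordinal tn) j) => [+ _|].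
  rewrite (mean_expectation P (bounded_discount _ _)) -EFinB abse_EFin lee_fin.
  by rewrite -[X in _ -> _ <= X]div1r.
by apply/funext => x; rewrite mul0r cos0 mulr1.
Qed.

End Knapsack.

(** * Choice of the parameters and the approximation guarantee *)

Theorem theorem6 (R : realType) (eps c : R) (heps : 0 < eps) (hc : 0 < c) :
  exists (prog : cmd) (k : nat),
  forall (n : nat) (w : 'I_n -> R) (T : R)
    (d : measure_display) (Omega : measurableType d) (P : probability Omega R)
    (v : 'I_n -> {RV P >-> R}) (q : oracle R),
    (forall i, 0 <= w i) ->
    0 < T ->
    (forall i x, 0 <= v i x) ->
    mutually_independent v ->
    computes_transforms v q ->
    (c%:E <= OPT w v T)%E ->
    exists (s : state R) (cost : nat),
      exec q prog (input w T) s cost /\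
      (cost <= k * n ^ k + k)%N /\
      let S := output n s in
      weight w S <= 1 + eps /\
      ((1 - eps)%:E * OPT w v T <= P [set x | ((1 - eps) * T < profit v S x)%R])%E.
Proof.
(* The cap at [1 / 2] gives [e < 1], as the choice of [A] and [L] requires; the claim for [e]
   implies the one for [eps]. *)
pose e := Num.min eps (1 / 2).
have e0 : 0 < e by rewrite lt_min heps; lra.
have e1 : e < 1 by rewrite gt_min; apply/orP; right; lra.
have e_eps : e <= eps by rewrite ge_min lexx.
(* The factor [c] makes the additive errors small relative to the optimum; the cap at 1 keeps
   [theta] at most [e / 4]. *)
pose theta := e * Num.min c 1 / 4.
have c10 : 0 < Num.min c 1 by rewrite lt_min hc ltr01.
have t0 : 0 < theta by rewrite divr_gt0 // mulr_gt0.
have tc : 4 * theta <= e * c.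
  by rewrite mulrC divfK // ler_pM2l // ge_min lexx.
have te : 4 * theta <= e.
  by rewrite mulrC divfK // ler_piMr ?(ltW e0) // ge_min lexx orbT.
have [A [L [L_small L_big]]] := @utility_parameters R e theta (introT andP (conj e0 e1)) t0.
have t1 : 0 < 1 - theta by lra.
pose K := (Num.trunc (2 ^+ L * 4 / theta)).+1.
have Kbig : 2 ^+ L * 4 <= theta * K%:R.
  rewrite [leRHS]mulrC -ler_pdivrMr // ltW //.
  have /truncn_itv/andP[_ //] : 0 <= 2 ^+ L * 4 / theta :> R.
  by rewrite divr_ge0 ?mulr_ge0 ?exprn_ge0 // ltW.
have K0 : (0 < K)%N by [].
clearbody K.
have [k Hk] := csz_knapsack_poly A L K.
exists (knapsack_prog A L K), k; move=> n w T d Omega P v q w0 T0 v0 v_indep qv c_OPT.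
pose b := (2 * n + (K * n.+1).+1 ^ L.+1 + (K * n.+1).+1 + A * L + L + 20)%N.
have b0 : (0 < b)%N by rewrite /b addnS.
have nb : (n <= b)%N.
  by rewrite /b mul2n -addnn -!addnA leq_addr.
pose wt := extend_ord w 0.
have sm : small b (input w T).
  by move=> x j; split=> //=; case: ifP => _; apply: bitlen_leq.
have [s [cost [run cost_le _ [S [out S_feasible S_best]]]]] :=
  @wp_knapsack R q A L K n b T wt (leqnn _) (input w T) erefl (fun=> erefl)
    erefl (fun=> erefl) sm.
exists s, cost; split=> //; split; first exact: leq_trans cost_le (Hk n).
have outE : output n s = [set i : 'I_n | S i]%SET.
  by apply/setP => i; rewrite !inE out //; case: (S i).
rewrite outE; set U := [set i : 'I_n | S i]%SET => /=.
split.
  rewrite -weight_of_set; apply: le_trans S_feasible _.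
  by rewrite lerDl ltW.
have best (V : {set 'I_n}) : weight w V <= 1 ->
    mean_utility T v A L V <= mean_utility T v A L U + theta.
  move=> wV; pose S' := extend_ord (fun i => i \in V) false.
  have VE : V = [set i : 'I_n | S' i]%SET.
    by apply/setP => i; rewrite inE /S' extend_ordE.
  have /S_best le : weight_of wt S' n <= 1 by rewrite weight_of_set -VE.
  pose m t j := extend_ord (fun i => transform T v A i j) 1 t.
  have m01 t j : 0 <= m t j <= 1.
    rewrite /m /extend_ord; case: insub => [i|]; last by rewrite ler01 lexx.
    exact: transform_itv.
  have query_m t j : (t < n)%N -> (j <= L)%N ->
      `|transform_query q A K n T t j - m t j| <= (K * n.+1).+1%:R^-1.
    by move=> tn _; exact: query_transform.
  have := score_le_value K0 m01 query_m Kbig le.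
  by rewrite !(value_of_set T0 v0 v_indep) -VE.
pose E := [set x | (1 - e) * T < profit v U x].
have mE : measurable E by exact: measurable_profit_gt.
pose x := fine (P E).
have Ex : P E = x%:E by rewrite fineK // fin_num_measure.
have xU : mean_utility T v A L U <= x + theta.
  by rewrite -lee_fin EFinD -Ex; apply: mean_utility_le => //; exact: ltW.
(* For feasible [V], [(1 - theta) P (v(V) >= T)] is at most the utility of [V], hence at most that
   of [U] plus [theta], hence at most [x + 2 * theta]. *)
have OPT_le : (OPT w v T <= ((x + 2 * theta) / (1 - theta))%:E)%E.
  apply: bigmax_le => [|V wV].
    by rewrite lee_fin (divr_ge0 _ (ltW t1)) // addr_ge0 ?fine_ge0 // mulr_ge0 // ltW.
  have mV : measurable [set y | T <= profit v V y].
    rewrite (_ : [set y | _] = level (profit v V) T).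
      by apply: measurable_level; exact: measurable_profit.
    by apply/seteqP; split=> y; rewrite /level /= in_itv /= andbT.
  have := mean_utility_ge T0 v0 V (ltW t0) L_small.
  have /fineK <- : P [set y | T <= profit v V y] \is a fin_num.
    exact: fin_num_measure.
  rewrite -EFinM !lee_fin ler_pdivlMr // mulrC => h.
  apply: le_trans h (le_trans (best V wV) _).
  by rewrite mulr_natl mulr2n addrA lerD2r.
apply: (@le_trans _ _ (P E)); last first.
  apply: le_measure; rewrite ?inE //; first exact: measurable_profit_gt.
  by move=> y; apply: le_lt_trans; rewrite ler_wpM2r ?(ltW T0) // lerD2l lerN2.
(* The optimum is finite by its two bounds. The loss [theta * r + 2 * theta] is at most [e * r],
   because [4 * theta <= e] and [4 * theta <= e * c <= e * r]. *)
rewrite Ex; move: c_OPT OPT_le; case: (OPT w v T) => [r||] //.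
rewrite -EFinM !lee_fin ler_pdivlMr // => cr rX.
have r0 : 0 <= r by apply: le_trans (ltW hc) cr.
have h1 : (1 - eps) * r <= (1 - e) * r by rewrite ler_wpM2r // lerD2l lerN2.
have h2 : 4 * theta * r <= e * r by rewrite ler_wpM2r.
have h3 : e * c <= e * r by rewrite ler_wpM2l // ltW.
by clear -rX h1 h2 h3 tc t0; lra.
Qed.
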